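(* Let $\mathcal{R}^\uparrow$ be the class of bivariate random vectors $(T,S)$ with $T,S\sim U(0,1)$ and $T$ stochastically increasing in $S$. Let $\mu$ be a real-valued functional on $\mathcal{R}^\uparrow$ such that $\mu(T,S)=0$ if and only if $T$ and $S$ are independent, $\mu(T,S)=1$ if and only if $T$ and $S$ are comonotone, and $(T,S)\le_c(T',S')$ implies $\mu(T,S)\le\mu(T',S')$. For random vectors $(Y,\mathbf{X})$ with $Y$ real-valued with continuous distribution function $F_Y$ and $\mathbf{X}$ in $\mathbb{R}^p$ ($p\in\mathbb{N}$ arbitrary), define $$\mathsf{R}_\mu(Y,\mathbf{X}):=\mu\big(F_Y\circ q_{Y;\mathbf{X}}^{\uparrow U}(V),U\big),$$ where $U,V$ are i.i.d. uniform on $(0,1)$. Then $$(Y,\mathbf{X})\preccurlyeq_{ccx}(Y',\mathbf{X}')\quad\text{implies}\quad\mathsf{R}_\mu(Y,\mathbf{X})\le\mathsf{R}_\mu(Y',\mathbf{X}').$$ Further, the following statements hold true: (i) $\mathsf{R}_\mu$ takes values in $[0,1]$. (ii) $\mathsf{R}_\mu$ has the zero-independence and max-functionality property. (iii) $\mathsf{R}_\mu$ satisfies information monotonicity, i.e. $\mathsf{R}_\mu(Y,\mathbf{X})\le\mathsf{R}_\mu(Y,(\mathbf{X},\mathbf{Z}))$ for all random vectors $\mathbf{X},\mathbf{Z}$. (iv) If, additionally, $\mu$ is strictly increasing on $\mathcal{R}^\uparrow$, then $\mathsf{R}_\mu(Y,\mathbf{X})=\mathsf{R}_\mu(Y,(\mathbf{X},\mathbf{Z}))$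 if and only if $Y$ and $\mathbf{Z}$ are conditionally independent given $\mathbf{X}$.
   Context: $T$ is stochastically increasing in $S$ if $\mathbb{E}[f(T)\mid S=t]$ is (has a version that is) increasing in $t$ for all increasing $f$ such that the expectations exist. Concordance order: $(T,S)\le_c(T',S')$ iff $P(T\le t,S\le s)\le P(T'\le t,S'\le s)$ and $P(T>t,S>s)\le P(T'>t,S'>s)$ for all $s,t\in\mathbb{R}$. $\mu$ is strictly increasing on $\mathcal{R}^\uparrow$ if $(T,S)\le_c(T',S')$ and $(T,S)\not\stackrel{d}{=}(T',S')$ imply $\mu(T,S)<\mu(T',S')$. For uniform marginals, $(T,S)$ comonotone means $T=S$ almost surely. Rearranged quantile transform: for a distribution function $G$ let $G^{-1}(v)=\inf\{y\mid G(y)\ge v\}$. The multivariate quantile transform $\mathbf{q}_{\mathbf{X}}\colon(0,1)^p\to\mathbb{R}^p$ is $\mathbf{q}_{\mathbf{X}}(\mathbf{u})=(x_1,\ldots,x_p)$ with $x_1=F_{X_1}^{-1}(u_1)$ and iteratively $x_i=F^{-1}_{X_i|X_{i-1}=x_{i-1},\ldots,X_1=x_1}(u_i)$. The decreasing rearrangement of an integrable $h\colon(0,1)^k\to\mathbb{R}$ is the (Lebesgue-essentially unique) decreasing $h^*\colon(0,1)\to\mathbb{R}$ with $\lambda(h^*\ge w)=\lambda^k(h\ge w)$ for all $w\in\mathbb{R}$. Let $(y,u)\mapsto F_u(y)$ be such that for every $y$ the map $u\mapsto F_u(y)$ is a decreasing rearrangement of $\mathbf{u}\mapsto P(Y\le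 y\mid\mathbf{X}=\mathbf{q}_{\mathbf{X}}(\mathbf{u}))$ and for every $u\in(0,1)$ the map $y\mapsto F_u(y)$ is a distribution function (such a version exists); then $q_{Y;\mathbf{X}}^{\uparrow u}(t):=F_u^{-1}(t)$, $t\in(0,1)$. The vector $(F_Y\circ q_{Y;\mathbf{X}}^{\uparrow U}(V),U)$ belongs to $\mathcal{R}^\uparrow$ when $F_Y$ is continuous. A functional $\kappa(Y,\mathbf{X})$ has the zero-independence property if $\kappa(Y,\mathbf{X})=0$ iff $Y$ and $\mathbf{X}$ are independent, and the max-functionality property if $\kappa(Y,\mathbf{X})=1$ iff $Y=f(\mathbf{X})$ a.s. for some measurable $f$. $q_Y=F_Y^{-1}$. For bounded random variables, $S\le_{cx}T$ means $\mathbb{E}\varphi(S)\le\mathbb{E}\varphi(T)$ for all convex $\varphi\colon\mathbb{R}\to\mathbb{R}$. Conditional convex order: $(Y,\mathbf{X})\preccurlyeq_{ccx}(Y',\mathbf{X}')$ means $P(Y\ge q_Y(v)\mid\mathbf{X})\le_{cx}P(Y'\ge q_{Y'}(v)\mid\mathbf{X}')$ for all $v\in(0,1)$ (the dimensions of $\mathbf{X},\mathbf{X}'$ may differ). *)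

(* Defs.v *)
From HB Require Import structures.
From mathcomp Require Import all_boot all_order all_algebra.
From mathcomp Require Import all_classical all_reals all_analysis.

Set Implicit Arguments.
Unset Strict Implicit.
Unset Printing Implicit Defensive.

Import Order.TTheory GRing.Theory Num.Theory.
Import numFieldNormedType.Exports.

Local Open Scope classical_set_scope.
Local Open Scope ring_scope.

Section conditioning.
Context (R : realType) (d : measure_display) (Om : measurableType d)
  (P : probability Om R).

Definition independent d1 d2 (E1 : measurableType d1) (E2 : measurableType d2)
    (X1 : Om -> E1) (X2 : Om -> E2) : Prop :=
  forall A B, measurable A -> measurable B ->
    P (X1 @^-1` A `&` X2 @^-1` B) = (P (X1 @^-1` A) * P (X2 @^-1` B))%E.

(* [g] is a version of x |-> E[f | X = x]; the random variable E[f | X] is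
   then [g \o X]. *)
Definition is_cond_exp (f : Om -> R) d' (E : measurableType d')
    (X : Om -> E) (g : E -> R) : Prop :=
  [/\ measurable_fun setT g,
      P.-integrable setT (EFin \o (g \o X)) &
      forall B, measurable B ->
        (\int[P]_(w in X @^-1` B) (g (X w))%:E
         = \int[P]_(w in X @^-1` B) (f w)%:E)%E].

(* [g] is a version of x |-> P(A | X = x). *)
Definition is_cond_prob (A : set Om) d' (E : measurableType d')
    (X : Om -> E) (g : E -> R) : Prop :=
  is_cond_exp (\1_A : Om -> R) X g.

(* Regular version of (x, y) |-> P(Y <= y | X = x): a distribution function in
   [y] for every [x]. *)
Definition is_cond_cdf (Y : Om -> R) d' (E : measurableType d')
    (X : Om -> E) (G : E -> cumulativeBounded (0 : R) (1 : R)) : Prop :=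
  forall y, is_cond_prob [set w | Y w <= y] X (fun x => G x y).

(* P(Y1 in A, Y2 in B | X) = P(Y1 in A | X) P(Y2 in B | X) a.s. *)
Definition cond_independent d1 d2 d3 (E1 : measurableType d1)
    (E2 : measurableType d2) (E : measurableType d3)
    (Y1 : Om -> E1) (Y2 : Om -> E2) (X : Om -> E) : Prop :=
  forall A B, measurable A -> measurable B ->
    exists g12 g1 g2 : E -> R,
      [/\ is_cond_prob (Y1 @^-1` A `&` Y2 @^-1` B) X g12,
          is_cond_prob (Y1 @^-1` A) X g1,
          is_cond_prob (Y2 @^-1` B) X g2 &
          {ae P, forall w, g12 (X w) = g1 (X w) * g2 (X w)}].

End conditioning.

Section quantiles.
Context (R : realType).

(* Only meaningful for a distribution function [G] and 0 < v < 1. *)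
Definition ginv (G : R -> R) (v : R) : R := inf [set y | v <= G y].

Definition Fdist (d : measure_display) (Om : measurableType d)
    (P : probability Om R) (Y : {RV P >-> R}) (y : R) : R := fine (cdf Y y).

Definition cons_pair n (x : measurableTypeR R * n.-tuple R) : n.+1.-tuple R :=
  [tuple of x.1 :: x.2].

Lemma measurable_cons_pair n : measurable_fun setT (@cons_pair n).
Proof. exact: measurable_cons. Qed.

HB.instance Definition _ n :=
  isMeasurableFun.Build _ _ _ _ (@cons_pair n) (@measurable_cons_pair n).

(* Lebesgue measure on the unit cube of R^n, as the n-fold product of the
   uniform distribution. *)
Fixpoint cube_measure n : probability (n.-tuple R) R :=
  if n is m.+1
  then distribution
         (uniform_prob (@ltr01 R) \x cube_measure m : probability _ R)%E
         (@cons_pair m)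
  else \d_([tuple] : 0.-tuple R).

Definition open_cube n : set (n.-tuple R) :=
  [set u | forall i, 0 < tnth u i < 1].

Definition is_dec_rearrangement k (h : k.-tuple R -> R) (hs : R -> R) : Prop :=
  (forall u v, 0 < u -> u <= v -> v < 1 -> hs v <= hs u) /\
  (forall w, lebesgue_measure [set u : R | 0 < u < 1 /\ w <= hs u]
             = cube_measure k (open_cube (n:=k) `&` [set u | w <= h u])).

(* The coordinates strictly before the [i]-th one. *)
Definition prefix_tuple p (i : 'I_p) (x : p.-tuple R) : i.-tuple R :=
  [tuple tnth x (widen_ord (ltnW (ltn_ord i)) j) | j < i].

(* The recursion x_i = F^-1_(X_i | X_(i-1) = x_(i-1), ..., X_1 = x_1)(u_i)
   determines [qX] on the open cube once versions [G i] of the conditional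
   distribution functions are chosen; for the first coordinate one conditions
   on the empty tuple, so that [G ord0 [tuple]] is the distribution function
   of X_1. *)
Definition is_mqt (d : measure_display) (Om : measurableType d)
    (P : probability Om R) p (X : {RV P >-> p.-tuple R})
    (qX : p.-tuple R -> p.-tuple R) : Prop :=
  exists G : forall i : 'I_p, i.-tuple R -> cumulativeBounded (0 : R) (1 : R),
    (forall i : 'I_p,
       is_cond_cdf P (fun w => tnth (X w) i) (fun w => prefix_tuple i (X w))
         (G i)) /\
    (forall u, open_cube u -> forall i : 'I_p,
       tnth (qX u) i = ginv (G i (prefix_tuple i (qX u))) (tnth u i)).

(* [q u t] is (a version of) q_(Y;X)^(up u)(t); [F u y] is F_u(y). *)
Definition is_rearranged_qt (d : measure_display) (Om : measurableType d)
    (P : probability Om R) (Y : {RV P >-> R}) p (X : {RV P >-> p.-tuple R})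
    (q : R -> R -> R) : Prop :=
  exists (qX : p.-tuple R -> p.-tuple R) (g : R -> p.-tuple R -> R)
         (F : R -> cumulativeBounded (0 : R) (1 : R)),
    [/\ is_mqt X qX,
        forall y, is_cond_prob P [set w | Y w <= y] X (g y),
        forall y, is_dec_rearrangement (fun u => g y (qX u)) (fun u => F u y) &
        forall u t, 0 < u < 1 -> 0 < t < 1 -> q u t = ginv (F u) t].

End quantiles.

(* A bivariate vector (T, S) on an arbitrary probability space; measurability
   is part of [Rup]. *)
Record bivector (R : realType) := Bivector {
  bv_disp : measure_display;
  bv_space : measurableType bv_disp;
  bv_prob : probability bv_space R;
  bv_T : bv_space -> R;
  bv_S : bv_space -> R }.
Arguments Bivector {R bv_disp bv_space} bv_prob bv_T bv_S.
Arguments bv_prob {R} b.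
Arguments bv_T {R} b _.
Arguments bv_S {R} b _.

Section bivariate.
Context (R : realType).

Definition uniform01 (d : measure_display) (Om : measurableType d)
    (P : probability Om R) (U : Om -> R) : Prop :=
  measurable_fun setT U /\
  forall A, measurable A -> P (U @^-1` A) = uniform_prob (@ltr01 R) A.

(* Increasing is meant in the weak sense. *)
Definition stoch_increasing (d : measure_display) (Om : measurableType d)
    (P : probability Om R) (T S : Om -> R) : Prop :=
  forall f : R -> R, {homo f : x y / x <= y} ->
    P.-integrable setT (EFin \o (f \o T)) ->
    exists g : R -> R, {homo g : x y / x <= y} /\ is_cond_exp P (f \o T) S g.

Definition Rup (W : bivector R) : Prop :=
  [/\ uniform01 (bv_prob W) (bv_T W),
      uniform01 (bv_prob W) (bv_S W) &
      stoch_increasing (bv_prob W) (bv_T W) (bv_S W)].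

Definition bv_independent (W : bivector R) : Prop :=
  independent (bv_prob W) (bv_T W) (bv_S W).

(* Comonotonicity for uniform marginals. *)
Definition bv_comonotone (W : bivector R) : Prop :=
  {ae bv_prob W, forall w, bv_T W w = bv_S W w}.

Definition concordance_le (W W' : bivector R) : Prop :=
  forall s t : R,
    (bv_prob W [set w | bv_T W w <= t /\ bv_S W w <= s]%R
     <= bv_prob W' [set w | bv_T W' w <= t /\ bv_S W' w <= s]%R)%E /\
    (bv_prob W [set w | bv_T W w > t /\ bv_S W w > s]%R
     <= bv_prob W' [set w | bv_T W' w > t /\ bv_S W' w > s]%R)%E.

Definition bv_eq_law (W W' : bivector R) : Prop :=
  forall A : set (R * R), measurable A ->
    bv_prob W [set w | A (bv_T W w, bv_S W w)]
    = bv_prob W' [set w | A (bv_T W' w, bv_S W' w)].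

Definition strictly_increasing_on_Rup (mu : bivector R -> R) : Prop :=
  forall W W', Rup W -> Rup W' ->
    concordance_le W W' -> ~ bv_eq_law W W' -> mu W < mu W'.

(* [r] is the value mu(F_Y o q_(Y;X)^(up U)(V), U) of R_mu(Y, X), for some
   versions of the objects defining q_(Y;X) and some i.i.d. uniform U, V with
   values in the open unit interval (where the quantile functions live).
   Different choices give vectors with the same law, hence, for the mu of
   interest, the same [r]. *)
Definition is_Rmu (mu : bivector R -> R) (d : measure_display)
    (Om : measurableType d) (P : probability Om R) (Y : {RV P >-> R})
    p (X : {RV P >-> p.-tuple R}) (r : R) : Prop :=
  exists (q : R -> R -> R) (d' : measure_display) (Om' : measurableType d')
         (Q : probability Om' R) (U V : {RV Q >-> R}),
    [/\ is_rearranged_qt Y X q,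
        uniform01 Q U /\ uniform01 Q V,
        independent Q U V,
        forall w, 0 < U w < 1 /\ 0 < V w < 1 &
        r = mu (Bivector Q (fun w => Fdist Y (q (U w) (V w))) U)].

End bivariate.

Section orders.
Context (R : realType).

(* S <=cx T, for random variables that are bounded (up to null sets). *)
Definition convex_le (d : measure_display) (Om : measurableType d)
    (P : probability Om R) (S : Om -> R)
    (d' : measure_display) (Om' : measurableType d')
    (P' : probability Om' R) (T : Om' -> R) : Prop :=
  forall phi : R -> R, @convex_function R R^o setT phi ->
    ('E_P[phi \o S] <= 'E_P'[phi \o T])%E.

(* The versions of the two conditional probabilities are a.s. unique, so that
   the choice of versions is immaterial. *)
Definition ccx_le (d : measure_display) (Om : measurableType d)
    (P : probability Om R) (Y : {RV P >-> R}) p (X : {RV P >-> p.-tuple R})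
    (d' : measure_display) (Om' : measurableType d')
    (P' : probability Om' R) (Y' : {RV P' >-> R}) p'
    (X' : {RV P' >-> p'.-tuple R}) : Prop :=
  forall v : R, 0 < v < 1 ->
    exists (g : p.-tuple R -> R) (g' : p'.-tuple R -> R),
      [/\ is_cond_prob P [set w | ginv (Fdist Y) v <= Y w] X g,
          is_cond_prob P' [set w | ginv (Fdist Y') v <= Y' w] X' g' &
          convex_le P (g \o X) P' (g' \o X')].

End orders.

Section joint_vector.
Context (R : realType) (d : measure_display) (Om : measurableType d)
  (P : probability Om R) (p q : nat).

Definition join_rv (X : {RV P >-> p.-tuple R}) (Z : {RV P >-> q.-tuple R})
    (w : Om) : (p + q).-tuple R := cat_tuple (X w) (Z w).

Lemma measurable_join_rv X Z : measurable_fun setT (join_rv X Z).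
Proof.
apply/measurable_fun_tnthP => i; rewrite /comp/=.
case: (split_ordP i) => j ->.
  apply: (eq_measurable_fun (fun w => tnth (X w) j)).
    by move=> w _; rewrite /join_rv tnth_lshift.
  exact: (measurableT_comp (measurable_tnth j) (measurable_funPT X)).
apply: (eq_measurable_fun (fun w => tnth (Z w) j)).
  by move=> w _; rewrite /join_rv tnth_rshift.
exact: (measurableT_comp (measurable_tnth j) (measurable_funPT Z)).
Qed.

HB.instance Definition _ X Z := isMeasurableFun.Build _ _ _ _
  (join_rv X Z) (measurable_join_rv X Z).

End joint_vector.

(* Main.v *)
Require Import Defs.
From HB Require Import structures.
From mathcomp Require Import all_boot all_order all_algebra.
From mathcomp Require Import all_classical all_reals all_analysis.
From mathcomp Require Import measurable_realfun lra ring.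

(** Fix [y] and write [h = P(Y <= y | X)].  By construction [F_U(y)] is a
    decreasing function of [U] with the law of [h], so that the copula of
    [(F_Y(q(U, V)), U)] at [(F_Y(y), s)] is
      C(y, s) = E[F_U(y); U <= s] = min_c (c s + E(h - c)^+),
    and conversely E(h - c)^+ = max_s (C(y, s) - c s).  Hence the copula is
    determined by the hinge functionals E(h - c)^+, monotonically in both
    directions, and every claim becomes a statement on these functionals:
    - the conditional convex order bounds them, hinges being convex;
    - conditioning on a finer vector increases them (Jensen), and equality for
      all [c] forces the two conditional probabilities to agree a.s.;
    - the last fact, applied to [P(Y <= y)] against [P(Y <= y | X)], gives
      zero-independence; applied to [P(Y <= y | X)] against
      [P(Y <= y | X, Y) = 1_{Y <= y}], it gives max-functionality; applied to
      [X] against [(X, Z)], it gives conditional independence. *)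

Set Implicit Arguments.
Unset Strict Implicit.
Unset Printing Implicit Defensive.

Import Order.TTheory GRing.Theory Num.Theory.
Import numFieldNormedType.Exports.

Local Open Scope classical_set_scope.
Local Open Scope ring_scope.
Local Notation unif R := (uniform_prob (@ltr01 R)).

(** The definition of [is_Rmu] leaves the versions, the transform [qX] and the space carrying [U]
    and [V] free, and [mu] is controlled only on [Rup]. Every argument therefore passes through
    [represents], which retains only the hinges of the conditional probabilities given [X] and the
    joint distribution function of the pair; different choices and different vectors become
    comparable. Reaching it requires that [qX] carry the uniform law of the cube to the law of [X].
    Continuity of the distribution function of [Y] enters three times: every level in (0,1) has the
    form [Fdist Y y], so inequalities at such levels cover the open unit square (uniform marginals
    fix the rest of the plane); [Fdist Y] of the rearranged quantile is uniform; and [P(Y = y) = 0]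
    lets the events [y <= Y] of the conditional convex order be exchanged for [Y <= y]. The calculus
    of conditional probabilities also rests on hinges: uniqueness of versions and their a.s. bounds
    are equality cases of the hinge inequality. *)

Lemma measurable_preimageT d d' (T : measurableType d) (T' : measurableType d')
    (X : T -> T') C :
  measurable_fun setT X -> measurable C -> measurable (X @^-1` C).
Proof. by move=> mX mC; rewrite -[X in measurable X]setTI; exact: mX. Qed.

Lemma measurable_le_fun (R : realType) d (T : measurableType d) (f g : T -> R) :
  measurable_fun setT f -> measurable_fun setT g ->
  measurable [set w | f w <= g w].
Proof.
move=> mf mg; rewrite -[X in measurable X]setTI.
have := measurable_fun_ler mf mg; move=> /(_ measurableT [set true]); exact.
Qed.

Lemma measurable_lt_fun (R : realType) d (T : measurableType d) (f g : T -> R) :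
  measurable_fun setT f -> measurable_fun setT g ->
  measurable [set w | f w < g w].
Proof.
move=> mf mg; rewrite (_ : mkset _ = ~` [set w | g w <= f w]); last first.
  by apply/seteqP; split => w /=; rewrite real_ltNge ?num_real//; move/negP.
by apply: measurableC; exact: measurable_le_fun.
Qed.

Lemma preimage_Iic (R : realType) T (X : T -> R) (x : R) :
  X @^-1` `]-oo, x] = [set w | X w <= x].
Proof. by apply/seteqP; split => w /=; rewrite in_itv. Qed.

(** * Uniqueness of laws *)

Section pi_lambda.
Context (R : realType) (d1 d2 d : measure_display) (Om1 : measurableType d1)
  (Om2 : measurableType d2) (E : measurableType d)
  (P1 : probability Om1 R) (P2 : probability Om2 R)
  (X1 : Om1 -> E) (X2 : Om2 -> E) (f1 : Om1 -> R) (f2 : Om2 -> R).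
Hypotheses (mX1 : measurable_fun setT X1) (mX2 : measurable_fun setT X2)
  (if1 : P1.-integrable setT (EFin \o f1))
  (if2 : P2.-integrable setT (EFin \o f2)).

Let I1 A := (\int[P1]_(w in X1 @^-1` A) (f1 w)%:E)%E.
Let I2 A := (\int[P2]_(w in X2 @^-1` A) (f2 w)%:E)%E.

(** The weights let one Dynkin argument serve equality of laws (weight 1), independence (an
    indicator against a constant) and conditional probabilities (a version against an indicator).
    Complements require a subtraction, whence the integrability of the weights. *)
Lemma weighted_law_unique (G : set (set E)) :
  measurable = <<s G >> -> setI_closed G -> I1 setT = I2 setT ->
  (forall A, G A -> I1 A = I2 A) -> forall A, measurable A -> I1 A = I2 A.
Proof.
have mp1 A : measurable A -> measurable (X1 @^-1` A).
  by move=> mA; rewrite -[X in measurable X]setTI; exact: mX1.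
have mp2 A : measurable A -> measurable (X2 @^-1` A).
  by move=> mA; rewrite -[X in measurable X]setTI; exact: mX2.
move=> mG GI IT IG; rewrite [X in forall A, X A -> _]mG.
apply: (@dynkin_induction _ _ G [set A | I1 A = I2 A]) => //=.
- move=> A mA IA; rewrite /I1 /I2.
  have eC T (X : T -> E) : X @^-1` (~` A) = setT `\` X @^-1` A.
    by rewrite setTD preimage_setC.
  rewrite !eC {eC}.
  have key d' (T : measurableType d') (Q : probability T R) (B : set T) (f : T -> R) :
      measurable B -> Q.-integrable setT (EFin \o f) ->
      (\int[Q]_(w in setT `\` B) (f w)%:E =
       \int[Q]_w (f w)%:E - \int[Q]_(w in B) (f w)%:E)%E.
    move=> mB fi; rewrite -[in X in (_ = X - _)%E](setDUK (@subsetT _ B)).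
    rewrite integral_setU//=; last 3 first.
    - exact: measurableD.
    - rewrite setDUK//; exact: measurable_int fi.
    - by rewrite disj_set2E setDIK.
    rewrite addeAC subee ?add0e//; apply: integrable_fin_num => //.
    exact: (integrableS measurableT).
  rewrite (key _ _ P1 _ _ (mp1 _ mA) if1) (key _ _ P2 _ _ (mp2 _ mA) if2).
  move: IT IA; rewrite /I1 /I2 !preimage_setT.
  by move=> -> ->.
- move=> F mF tF IF; rewrite /I1 /I2 !preimage_bigcup.
  have trivp T (X : T -> E) : trivIset setT (fun i => X @^-1` F i).
    apply/trivIsetP => i j _ _ ij; rewrite -preimage_setI.
    by move/trivIsetP : tF => /(_ _ _ I I ij) ->; rewrite preimage_set0.
  rewrite (@integral_bigcup _ _ _ P1) ?(@integral_bigcup _ _ _ P2)//.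
  + by apply: eq_eseriesr => i _; exact: IF.
  + by move=> k; exact: mp2.
  + by apply: integrableS if2 => //; apply: bigcupT_measurable => k; exact: mp2.
  + by move=> k; exact: mp1.
  + by apply: integrableS if1 => //; apply: bigcupT_measurable => k; exact: mp1.
Qed.


End pi_lambda.

Lemma measurable_IicE (R : realType) :
  @measurable _ R = <<s [set A : set R | exists y, A = `]-oo, y]%classic] >>.
Proof.
set G := [set A | _].
apply: (etrans (RGenOInfty.measurableE R)); rewrite eqEsubset; split => A.
    apply: smallest_sub; first exact: smallest_sigma_algebra.
    move=> _ [x ->]; rewrite -setCitvl.
    apply: (@measurableC _ (g_sigma_algebraType G)).
    by apply: sub_sigma_algebra; exists x.
  apply: smallest_sub; first exact: smallest_sigma_algebra.
  move=> _ [x ->]; rewrite -setCitvr.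
  apply: (@measurableC _ (g_sigma_algebraType (@RGenOInfty.G R))).
  by apply: sub_sigma_algebra; exists x.
Qed.

Lemma measurable_fun_Iic (R : realType) d (T : measurableType d) (f : T -> R) :
  (forall y, measurable [set w | f w <= y]) -> measurable_fun setT f.
Proof.
move=> mf; apply: (measurability _ (measurable_IicE R)) => _ [_ [y ->] <-].
by rewrite setTI (_ : _ @^-1` _ = [set w | f w <= y]).
Qed.

Section pi_lambda_generators.
Context (R : realType) (d1 d2 : measure_display) (Om1 : measurableType d1)
  (Om2 : measurableType d2) (P1 : probability Om1 R) (P2 : probability Om2 R)
  (f1 : Om1 -> R) (f2 : Om2 -> R).
Hypotheses (if1 : P1.-integrable setT (EFin \o f1))
  (if2 : P2.-integrable setT (EFin \o f2)).

Lemma weighted_law_unique_ray (X1 : Om1 -> R) (X2 : Om2 -> R) :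
  measurable_fun setT X1 -> measurable_fun setT X2 ->
  (\int[P1]_w (f1 w)%:E = \int[P2]_w (f2 w)%:E)%E ->
  (forall y : R, \int[P1]_(w in [set w | X1 w <= y]%R) (f1 w)%:E =
             \int[P2]_(w in [set w | X2 w <= y]%R) (f2 w)%:E)%E ->
  forall A, measurable A ->
    (\int[P1]_(w in X1 @^-1` A) (f1 w)%:E =
     \int[P2]_(w in X2 @^-1` A) (f2 w)%:E)%E.
Proof.
move=> mX1 mX2 eT ey; pose G := [set A : set R | exists y, A = `]-oo, y]%classic].
apply: (@weighted_law_unique _ _ _ _ _ _ _ _ _ _ _ _ _ mX1 mX2 if1 if2 G).
- exact: measurable_IicE.
- move=> _ _ [x ->] [y ->]; exists (Num.min x y); apply/seteqP; split => z /=.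
    by rewrite !in_itv/= le_min => -[-> ->].
  by rewrite !in_itv/= le_min => /andP[-> ->].
- by rewrite !preimage_setT.
- move=> _ [y ->].
  by rewrite !preimage_Iic; exact: ey.
Qed.

Lemma weighted_law_unique_prod d d' (E : measurableType d)
    (E' : measurableType d') (X1 : Om1 -> E) (X2 : Om2 -> E)
    (Y1 : Om1 -> E') (Y2 : Om2 -> E') :
  measurable_fun setT X1 -> measurable_fun setT X2 ->
  measurable_fun setT Y1 -> measurable_fun setT Y2 ->
  (forall A B, measurable A -> measurable B ->
    \int[P1]_(w in X1 @^-1` A `&` Y1 @^-1` B) (f1 w)%:E =
    \int[P2]_(w in X2 @^-1` A `&` Y2 @^-1` B) (f2 w)%:E)%E ->
  forall C, measurable C ->
    (\int[P1]_(w in [set w | C (X1 w, Y1 w)]) (f1 w)%:E =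
     \int[P2]_(w in [set w | C (X2 w, Y2 w)]) (f2 w)%:E)%E.
Proof.
move=> mX1 mX2 mY1 mY2 eAB.
have mZ1 : measurable_fun setT (fun w => (X1 w, Y1 w)) by exact: measurable_fun_pair.
have mZ2 : measurable_fun setT (fun w => (X2 w, Y2 w)) by exact: measurable_fun_pair.
pose G := [set A1 `*` A2 | A1 in @measurable _ E & A2 in @measurable _ E'].
apply: (@weighted_law_unique _ _ _ _ _ _ _ _ _ _ _ _ _ mZ1 mZ2 if1 if2 G).
- exact: measurable_prod_measurableType.
- move=> _ _ [X mX [X' mX' <-]] [Y mY [Y' mY' <-]].
  exists (X `&` Y); first exact: measurableI.
  by exists (X' `&` Y'); [exact: measurableI|rewrite setXI].
- by rewrite -setXTT; exact: (eAB _ _ measurableT measurableT).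
- by move=> _ [A mA [B mB <-]]; exact: (eAB _ _ mA mB).
Qed.

End pi_lambda_generators.

Section pi_lambda_prod_ray.
Context (R : realType) (d1 d2 : measure_display) (Om1 : measurableType d1)
  (Om2 : measurableType d2) (P1 : probability Om1 R) (P2 : probability Om2 R)
  (f1 : Om1 -> R) (f2 : Om2 -> R).
Hypotheses (if1 : P1.-integrable setT (EFin \o f1))
  (if2 : P2.-integrable setT (EFin \o f2)).

(** For fixed [A], the restriction to [X] in [A] is absorbed into the weight, which leaves a
    statement about rays for [Y] alone; the equality without rays supplies the total masses. *)
Lemma weighted_law_unique_prod_ray d (E : measurableType d)
    (X1 : Om1 -> E) (X2 : Om2 -> E) (Y1 : Om1 -> R) (Y2 : Om2 -> R) :
  measurable_fun setT X1 -> measurable_fun setT X2 ->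
  measurable_fun setT Y1 -> measurable_fun setT Y2 ->
  (forall A, measurable A ->
    \int[P1]_(w in X1 @^-1` A) (f1 w)%:E =
    \int[P2]_(w in X2 @^-1` A) (f2 w)%:E)%E ->
  (forall A y, measurable A ->
    \int[P1]_(w in X1 @^-1` A `&` [set w | Y1 w <= y]%R) (f1 w)%:E =
    \int[P2]_(w in X2 @^-1` A `&` [set w | Y2 w <= y]%R) (f2 w)%:E)%E ->
  forall C, measurable C ->
    (\int[P1]_(w in [set w | C (X1 w, Y1 w)]) (f1 w)%:E =
     \int[P2]_(w in [set w | C (X2 w, Y2 w)]) (f2 w)%:E)%E.
Proof.
move=> mX1 mX2 mY1 mY2 eA eAy.
apply: weighted_law_unique_prod => // A B mA mB.
have mp d0 d' (T : measurableType d0) (T' : measurableType d') (X : T -> T') C :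
    measurable_fun setT X -> measurable C -> measurable (X @^-1` C).
  by move=> mX mC; rewrite -[X in measurable X]setTI; exact: mX.
have key d0 (T : measurableType d0) (Q : probability T R) (f : T -> R) C D :
    measurable C ->
    (\int[Q]_(w in C `&` D) (f w)%:E =
     \int[Q]_(w in D) ((f \_ C) w)%:E)%E.
  move=> mC; rewrite setIC integral_mkcondr; apply: eq_integral => w _.
  by rewrite restrict_EFin.
have ikey d0 (T : measurableType d0) (Q : probability T R) (f : T -> R) C :
    measurable C -> Q.-integrable setT (EFin \o f) ->
    Q.-integrable setT (EFin \o (f \_ C)).
  move=> mC fi; rewrite -restrict_EFin.
  by apply/(integrable_mkcond _ mC); exact: integrableS fi.
have [mA1 mA2] := (mp _ _ _ _ _ _ mX1 mA, mp _ _ _ _ _ _ mX2 mA).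
rewrite !key//; apply: weighted_law_unique_ray => //; [exact: ikey|exact: ikey| |].
- by rewrite -!key// !setIT; exact: eA.
- by move=> y; rewrite -!key//; exact: eAy.
Qed.

End pi_lambda_prod_ray.

Section law_unique.
Context (R : realType) (d1 d2 : measure_display) (Om1 : measurableType d1)
  (Om2 : measurableType d2) (P1 : probability Om1 R) (P2 : probability Om2 R).

Let integrable1 d (T : measurableType d) (P : probability T R) :
  P.-integrable setT (EFin \o (fun=> 1)).
Proof. exact: finite_measure_integrable_cst. Qed.

Let integral1 d (T : measurableType d) (P : probability T R) B :
  measurable B -> (\int[P]_(w in B) 1%:E = P B)%E.
Proof. by move=> mB; rewrite integral_cst// mul1e. Qed.

Lemma law_unique_ray (Y1 : Om1 -> R) (Y2 : Om2 -> R) :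
  measurable_fun setT Y1 -> measurable_fun setT Y2 ->
  (forall y, P1 [set w | Y1 w <= y] = P2 [set w | Y2 w <= y]) ->
  forall A, measurable A -> P1 (Y1 @^-1` A) = P2 (Y2 @^-1` A).
Proof.
move=> mY1 mY2 ey A mA.
have mYy d (T : measurableType d) (Y : T -> R) y : measurable_fun setT Y ->
  measurable [set w | Y w <= y] by move=> mY; exact: measurable_le_fun.
have eT : (\int[P1]_w 1%:E = \int[P2]_w 1%:E)%E.
  by rewrite !integral1// !probability_setT.
have eY (y : R) : (\int[P1]_(w in [set w | Y1 w <= y]%R) 1%:E =
    \int[P2]_(w in [set w | Y2 w <= y]%R) 1%:E)%E.
  by rewrite (integral1 P1 (mYy _ _ _ y mY1)) (integral1 P2 (mYy _ _ _ y mY2)).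
have := weighted_law_unique_ray (integrable1 P1) (integrable1 P2) mY1 mY2 eT eY mA.
by rewrite !integral1//; exact: measurable_preimageT mA.
Qed.

Lemma law_unique_prod_ray d (E : measurableType d)
    (X1 : Om1 -> E) (X2 : Om2 -> E) (Y1 : Om1 -> R) (Y2 : Om2 -> R) :
  measurable_fun setT X1 -> measurable_fun setT X2 ->
  measurable_fun setT Y1 -> measurable_fun setT Y2 ->
  (forall A, measurable A -> P1 (X1 @^-1` A) = P2 (X2 @^-1` A)) ->
  (forall A y, measurable A -> P1 (X1 @^-1` A `&` [set w | Y1 w <= y]) =
    P2 (X2 @^-1` A `&` [set w | Y2 w <= y])) ->
  forall C, measurable C ->
    P1 [set w | C (X1 w, Y1 w)] = P2 [set w | C (X2 w, Y2 w)].
Proof.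
move=> mX1 mX2 mY1 mY2 eA eAy C mC.
have mXA d' (T : measurableType d') (X : T -> E) A :
    measurable_fun setT X -> measurable A -> measurable (X @^-1` A).
  exact: measurable_preimageT.
have mYy d' (T : measurableType d') (Y : T -> R) y : measurable_fun setT Y ->
  measurable [set w | Y w <= y] by move=> mY; exact: measurable_le_fun.
have mXY d' (T : measurableType d') (X : T -> E) (Y : T -> R) :
    measurable_fun setT X -> measurable_fun setT Y ->
    measurable [set w | C (X w, Y w)].
  move=> mX mY; exact: (measurable_preimageT (measurable_fun_pair mX mY) mC).
have := @weighted_law_unique_prod_ray _ _ _ _ _ P1 P2 _ _ (integrable1 P1)
  (integrable1 P2) _ _ _ _ _ _ mX1 mX2 mY1 mY2 _ _ _ mC.
rewrite (integral1 P1 (mXY _ _ _ _ mX1 mY1)) (integral1 P2 (mXY _ _ _ _ mX2 mY2)).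
apply=> [A mA|A y mA].
  by rewrite (integral1 P1 (mXA _ _ _ _ mX1 mA)) (integral1 P2 (mXA _ _ _ _ mX2 mA)) eA.
rewrite (integral1 P1 (measurableI _ _ (mXA _ _ _ _ mX1 mA) (mYy _ _ _ y mY1))).
rewrite (integral1 P2 (measurableI _ _ (mXA _ _ _ _ mX2 mA) (mYy _ _ _ y mY2))).
exact: eAy.
Qed.

End law_unique.


(** * The uniform law and independent uniform variables *)

Lemma uniform_probE (R : realType) (A : set R) : measurable A ->
  unif R A = lebesgue_measure (A `&` `[0, 1]%classic).
Proof.
move=> mA; rewrite /uniform_prob integral_uniform_pdf.
rewrite (eq_integral (cst 1%E)); last first.
  move=> x; rewrite inE => -[_]; rewrite /= in_itv/= /uniform_pdf => ->.
  by rewrite subr0 invr1.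
by rewrite integral_cst ?mul1e//; exact: measurableI.
Qed.

Lemma uniform_prob_Iic (R : realType) (t : R) : 0 <= t <= 1 ->
  unif R `]-oo, t] = t%:E.
Proof.
move=> /andP[t0 t1]; rewrite uniform_probE//.
rewrite (_ : _ `&` _ = `[0, t]%classic); last first.
  apply/seteqP; split => x /=; rewrite !in_itv/=.
    by move=> [-> /andP[->]].
  by move=> /andP[-> xt]; split => //=; exact: le_trans t1.
rewrite lebesgue_measure_itv/= lte_fin; case: ltgtP t0 => // [t0 _|<- _//].
by rewrite -EFinD subr0.
Qed.

Section fubini_independent.
Context (R : realType) (d d' : measure_display) (Om : measurableType d)
  (E : measurableType d') (P : probability Om R) (W : Om -> E) (U : Om -> R).
Hypotheses (mW : measurable_fun setT W) (uU : uniform01 P U)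
  (iWU : independent P W U).

(** Independence identifies the joint law of [(W, U)] with the product measure, by uniqueness on
    rectangles; Tonelli's theorem does the rest. *)
Lemma integral_independent_uniform (k : E * measurableTypeR R -> \bar R) :
  measurable_fun setT k -> (forall x, 0 <= k x)%E ->
  (\int[P]_w k (W w, U w) = \int[P]_w (\int[unif R]_t k (W w, t)))%E.
Proof.
move=> mk k0; have [mU lU] := uU.
pose W' : {RV P >-> E} := mfun_Sub (mem_set mW).
have mWU : measurable_fun setT (fun w => (W w, U w : measurableTypeR R)).
  exact: measurable_fun_pair.
pose WU : {RV P >-> (E * measurableTypeR R)%type} := mfun_Sub (mem_set mWU).
rewrite -(ge0_integral_distribution WU mk k0).
have -> : (\int[distribution P WU]_x k x =
           \int[(distribution P W' \x unif R)%E]_x k x)%E.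
  apply: eq_measure_integral => A mA _; apply/esym.
  apply: product_measure_unique => //= B C mB mC.
  rewrite /distribution/= /pushforward/=.
  by rewrite (_ : _ @^-1` _ = W @^-1` B `&` U @^-1` C)// iWU// lU.
rewrite fubini_tonelli1// ge0_integral_distribution//.
- exact: measurable_fun_fubini_tonelli_F.
- by move=> y; apply: integral_ge0.
Qed.

(** Given [W], an independent uniform variable falls below [h (W)] with probability [h (W)]. Both
    quantile transforms run on this: the Galois connection of [ginv] brings their events into this
    form. *)
Lemma probability_uniform_le (h : E -> R) D :
  measurable_fun setT h -> measurable D -> (forall x, D x -> 0 <= h x <= 1) ->
  (P (W @^-1` D `&` [set w | U w <= h (W w)]%R) =
   \int[P]_(w in W @^-1` D) (h (W w))%:E)%E.
Proof.
move=> mh mD h01.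
pose C := [set x : E * measurableTypeR R | D x.1 /\ x.2 <= h x.1].
have mC : measurable C.
  apply: (@measurableI _ _ (fst @^-1` D) [set x : E * measurableTypeR R | x.2 <= h x.1]).
    exact: measurable_preimageT.
  by apply: measurable_le_fun => //; exact: measurableT_comp.
have mS : measurable (W @^-1` D `&` [set w | U w <= h (W w)]%R).
  apply: measurableI; first exact: measurable_preimageT.
  apply: measurable_le_fun; first by case: uU.
  exact: measurableT_comp.
rewrite -[in LHS](setIT (_ `&` _)) -integral_indic//.
have -> : (\int[P]_w (\1_(W @^-1` D `&` [set w | (U w <= h (W w))%R]) w)%:E
   = \int[P]_w (EFin \o \1_C) (W w, U w))%E.
  by apply: eq_integral => w _; rewrite /= !indicE.
rewrite integral_independent_uniform//; last 2 first.
- by apply/measurable_EFinP; exact: measurable_indic.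
- by move=> x; rewrite /= lee_fin.
rewrite [RHS]integral_mkcond; apply: eq_integral => w _.
rewrite /= patchE; case: ifPn => wD.
  move: wD; rewrite inE /= => wD.
  rewrite -(uniform_prob_Iic (h01 _ wD)) -[in RHS](setIT (`]-oo, _]%classic)).
  rewrite -integral_indic//; apply: eq_integral => t _.
  by rewrite !indicE; congr (_ _)%:E; congr nat_of_bool; apply/idP/idP;
    rewrite !inE/= in_itv/= /C/=; [case|].
rewrite integral0_eq// => t _; rewrite indicE memNset//.
by move: wD; rewrite notin_setE /= => wD [].
Qed.

End fubini_independent.

(** * Quantile transforms *)

Section generalized_inverse.
Context (R : realType) (G : R -> R).
Hypotheses (ndG : {homo G : x y / x <= y}) (rcG : right_continuous G)
  (G0 : G x @[x --> -oo] --> (0 : R)) (G1 : G x @[x --> +oo] --> (1 : R)).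

Lemma cdf_range y : 0 <= G y <= 1.
Proof.
apply/andP; split.
  apply: (cvgr_to_le G0); near=> z; apply: ndG.
  by near: z; apply: nbhs_ninfty_le; exact: num_real.
apply: (cvgr_to_ge G1); near=> z; apply: ndG.
by near: z; apply: nbhs_pinfty_ge; exact: num_real.
Unshelve. all: by end_near. Qed.

(** A Galois connection: the limits at infinity make the defining set nonempty and bounded below for
    levels in (0,1), and right continuity puts its infimum into it. *)
Lemma ginv_le v y : 0 < v < 1 -> (ginv G v <= y) = (v <= G y).
Proof.
move=> /andP[v0 v1]; set S := [set y | v <= G y].
have lbS : has_lbound S.
  have : \forall z \near -oo, G z < v by exact: (cvgr_lt _ G0).
  move=> [M [_ HM]]; exists (M - 1) => x; rewrite /S /= => vx.
  rewrite leNgt; apply/negP => xM.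
  have : G x < v by apply: HM; rewrite (lt_trans xM)// gtrBl.
  by rewrite ltNge vx.
have S0 : S !=set0.
  have : \forall z \near +oo, v < G z by exact: (cvgr_gt _ G1).
  move=> [M [_ HM]]; exists (M + 1); rewrite /S /=; apply: ltW; apply: HM.
  by rewrite ltrDl.
have infS : v <= G (ginv G v).
  have cr : G z @[z --> (ginv G v)^'+] --> G (ginv G v) by exact: rcG.
  apply: (cvgr_to_ge cr); near=> z.
  have : ginv G v < z by near: z; exact: nbhs_right_gt.
  by move=> /(inf_lt S0)[s vs sz]; rewrite (le_trans vs)// ndG// ltW.
apply/idP/idP => [gy|vy]; first by rewrite (le_trans infS)// ndG.
exact: ge_inf.
Unshelve. all: by end_near. Qed.

Lemma ginvK v : continuous G -> 0 < v < 1 -> G (ginv G v) = v.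
Proof.
move=> cG v01; apply/eqP; rewrite eq_le -ginv_le// lexx andbT.
have cl : G z @[z --> (ginv G v)^'-] --> G (ginv G v).
  by apply: cvg_at_left_filter; exact: cG.
apply: (cvgr_to_le cl); near=> z.
have : z < ginv G v by near: z; exact: nbhs_left_lt.
by rewrite ltNge ginv_le// -ltNge => /ltW.
Unshelve. all: by end_near. Qed.

End generalized_inverse.

Section cumulative.
Context (R : realType) (F : cumulativeBounded (0 : R) (1 : R)).

Lemma cumulative01_range y : 0 <= F y <= 1.
Proof.
by apply: cdf_range; [exact: cumulative_is_nondecreasing|exact: cumulativeNy
  |exact: cumulativey].
Qed.

Lemma ginv_cumulative_le v y : 0 < v < 1 -> (ginv F v <= y) = (v <= F y).
Proof.
apply: ginv_le; [exact: cumulative_is_nondecreasing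
  |exact: cumulative_is_right_continuous|exact: cumulativeNy|exact: cumulativey].
Qed.

End cumulative.

Section distribution_function.
Context (R : realType) (d : measure_display) (Om : measurableType d)
  (P : probability Om R) (Y : {RV P >-> R}).

Lemma FdistE y : P [set w | Y w <= y] = (Fdist Y y)%:E.
Proof.
by rewrite /Fdist fineK ?fin_num_measure.
Qed.

Lemma Fdist_nd : {homo Fdist Y : x y / x <= y}.
Proof.
by move=> x y xy; rewrite /Fdist fine_le ?fin_num_measure// cdf_nondecreasing.
Qed.

Lemma Fdist_rc : right_continuous (Fdist Y).
Proof.
move=> a; apply: fine_cvg.
by rewrite fineK ?fin_num_measure//; exact: cdf_right_continuous.
Qed.

Lemma Fdist_cvgNy : Fdist Y x @[x --> -oo] --> (0 : R).
Proof. exact/fine_cvg/cvg_cdfNy0. Qed.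

Lemma Fdist_cvgy : Fdist Y x @[x --> +oo] --> (1 : R).
Proof. exact/fine_cvg/cvg_cdfy1. Qed.

Lemma Fdist_range y : 0 <= Fdist Y y <= 1.
Proof.
apply: cdf_range; [exact: Fdist_nd|exact: Fdist_cvgNy|exact: Fdist_cvgy].
Qed.

Lemma Fdist_ginv v : continuous (Fdist Y) -> 0 < v < 1 ->
  Fdist Y (ginv (Fdist Y) v) = v.
Proof.
apply: ginvK; [exact: Fdist_nd|exact: Fdist_rc|exact: Fdist_cvgNy|exact: Fdist_cvgy].
Qed.

End distribution_function.

Lemma ge0_integral_eq_law (R : realType) d1 d2 d (Om1 : measurableType d1)
    (Om2 : measurableType d2) (E : measurableType d)
    (P1 : probability Om1 R) (P2 : probability Om2 R)
    (X1 : Om1 -> E) (X2 : Om2 -> E) (f : E -> \bar R) :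
  measurable_fun setT X1 -> measurable_fun setT X2 ->
  (forall A, measurable A -> P1 (X1 @^-1` A) = P2 (X2 @^-1` A)) ->
  measurable_fun setT f -> (forall x, 0 <= f x)%E ->
  forall A, measurable A ->
  (\int[P1]_(w in X1 @^-1` A) f (X1 w) = \int[P2]_(w in X2 @^-1` A) f (X2 w))%E.
Proof.
move=> mX1 mX2 eX mf f0 A mA.
have h1 := @ge0_integral_pushforward _ _ _ _ R X1 mX1 P1 A f mA.
have h2 := @ge0_integral_pushforward _ _ _ _ R X2 mX2 P2 A f mA.
rewrite -[LHS]h1; [|exact: measurable_funTS|by move=> *; exact: f0].
rewrite -[RHS]h2; [|exact: measurable_funTS|by move=> *; exact: f0].
by apply: eq_measure_integral => B mB _; exact: eX.
Qed.

(** * The uniform measure on the cube and its coordinates *)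

Section cube.
Context (R : realType).

(** The induction over coordinates stays in the fixed type [p.-tuple R]: the first coordinates are
    kept and the others overwritten by a filler. This map brings the prefixes, whose type depends on
    the index, into that type. *)
Definition embed_tuple p n (z : n.-tuple R) : p.-tuple R :=
  [tuple nth 2^-1 z j | j < p].

(* The filler [1/2] keeps the tuple in the open cube. *)
Definition reset_tail p n (x : p.-tuple R) : p.-tuple R :=
  [tuple if (j < n)%N then tnth x j else 2^-1 | j < p].

Lemma measurable_embed_tuple p n : measurable_fun setT (@embed_tuple p n).
Proof.
apply/measurable_fun_tnthP => j; rewrite /comp/=.
have [jn|nj] := ltnP j n.
  apply: (eq_measurable_fun (fun z : n.-tuple R => tnth z (Ordinal jn))).
    by move=> z _; rewrite tnth_mktuple (tnth_nth 2^-1).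
  exact: measurable_tnth.
apply: (eq_measurable_fun (fun _ : n.-tuple R => 2^-1 : R)) => //.
by move=> z _; rewrite tnth_mktuple nth_default// size_tuple.
Qed.

Lemma measurable_reset_tail p n : measurable_fun setT (@reset_tail p n).
Proof.
apply/measurable_fun_tnthP => j; rewrite /comp/=.
have [jn|nj] := ltnP j n.
  apply: (eq_measurable_fun (fun z : p.-tuple R => tnth z j)).
    by move=> z _; rewrite tnth_mktuple jn.
  exact: measurable_tnth.
apply: (eq_measurable_fun (fun _ : p.-tuple R => 2^-1 : R)) => //.
by move=> z _; rewrite tnth_mktuple ltnNge nj.
Qed.

Lemma reset_tailE p (i : 'I_p) (x : p.-tuple R) :
  reset_tail i x = embed_tuple p (prefix_tuple i x).
Proof.
apply: eq_from_tnth => j; rewrite !tnth_mktuple; case: ltnP => ji.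
  rewrite -(tnth_nth _ _ (Ordinal ji)) tnth_mktuple.
  by congr (tnth x _); exact: val_inj.
by rewrite nth_default// size_tuple.
Qed.

Lemma prefix_tuple_reset_tail p (i : 'I_p) (x : p.-tuple R) :
  prefix_tuple i (reset_tail i x) = prefix_tuple i x.
Proof.
by apply: eq_from_tnth => j; rewrite !tnth_mktuple /= ltn_ord.
Qed.

Lemma open_cube_reset_tail p n (x : p.-tuple R) :
  open_cube x -> open_cube (reset_tail n x).
Proof.
move=> ox j; rewrite tnth_mktuple; case: ifP => // _.
by rewrite invr_gt0 ltr0n/= invf_lt1// ltr1n.
Qed.

Lemma reset_tail_full p (x : p.-tuple R) : reset_tail p x = x.
Proof. by apply: eq_from_tnth => j; rewrite tnth_mktuple ltn_ord. Qed.

(** This is the independence of the [i]-th coordinate from the preceding ones. The induction follows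
    the recursive definition of the cube measure, which splits off the first coordinate. *)
Lemma cube_measure_reset_tail p (i : 'I_p) (A : set (p.-tuple R)) (B : set R) :
  measurable A -> measurable B ->
  (cube_measure R p [set u | A (reset_tail i u) /\ B (tnth u i)] =
   cube_measure R p (reset_tail i @^-1` A) * unif R B)%E.
Proof.
elim: p i A B => [[]//|p IH] i A B mA mB.
have mrA (j : nat) : measurable (@reset_tail p.+1 j @^-1` A).
  by apply: measurable_preimageT => //; exact: measurable_reset_tail.
have mS (j : 'I_p.+1) : measurable [set u | A (reset_tail j u) /\ B (tnth u j)].
  apply: measurableI; first exact: mrA.
  by apply: (measurable_preimageT (measurable_tnth j)).
pose mu : probability _ R := (unif R \x cube_measure R p)%E.
have cubeE S : cube_measure R p.+1 S = mu (@cons_pair R p @^-1` S) by [].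
rewrite !cubeE.
have mc S : measurable S -> measurable (@cons_pair R p @^-1` S).
  by move=> mS'; apply: measurable_preimageT => //; exact: measurable_cons_pair.
case: (unliftP ord0 i) => [j|] ->{i}; last first.
  (* Nothing precedes the first coordinate: [reset_tail 0] is constant, so the event about [A] is
     either everything or empty. *)
  have r0 (u v : p.+1.-tuple R) : reset_tail 0 u = reset_tail 0 v.
    by apply: eq_from_tnth => k; rewrite !tnth_mktuple.
  pose z : p.+1.-tuple R := [tuple 0 | _ < p.+1].
  have [Az|Az] := pselect (A (reset_tail 0 z)).
    rewrite (_ : reset_tail ord0 @^-1` A = setT); last first.
      by apply/seteqP; split => // u _; rewrite /preimage/= (r0 _ z).
    rewrite preimage_setT probability_setT mul1e.
    rewrite (_ : _ @^-1` _ = B `*` setT); last first.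
      apply/seteqP; split => -[x u] /=; first by case.
      by move=> [Bx _]; split => //; rewrite (r0 _ z).
    rewrite [LHS]product_measure1E// -[RHS]mule1; congr (_ * _)%E.
    exact: (probability_setT (cube_measure R p)).
  rewrite (_ : _ @^-1` _ = set0); last first.
    by apply/seteqP; split => // -[x u] /= []; rewrite (r0 _ z).
  rewrite (_ : _ @^-1` (_ @^-1` A) = set0); last first.
    by apply/seteqP; split => // -[x u] /=; rewrite (r0 _ z).
  by rewrite measure0 mul0e.
(* For a later coordinate, the induction hypothesis is applied to each slice at a fixed first
   coordinate [x], and the result is integrated over [x]. *)
have rS x (u : p.-tuple R) :
    reset_tail (bump 0 j) (cons_pair (x, u)) = cons_pair (x, reset_tail j u).
  apply: eq_from_tnth => k; rewrite tnth_mktuple.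
  case: (unliftP ord0 k) => [l|] ->; last by rewrite !tnth0.
  by rewrite !tnthS tnth_mktuple.
have mAx (x : R) : measurable [set u : p.-tuple R | A (cons_pair (x, u))].
  apply: (@measurable_preimageT _ _ _ _ (fun u => cons_pair (x, u))) => //.
  exact: (measurableT_comp (@measurable_cons_pair R p)
    (@pair1_measurable _ _ (measurableTypeR R) (p.-tuple R) x)).
rewrite /mu/= /product_measure1/=.
rewrite -ge0_integralZr//; last first.
  apply: (@measurable_fun_xsection _ _ _ _ _ (cube_measure R p)).
  by apply: mc; exact: mrA.
apply: eq_integral => x _.
rewrite (_ : xsection _ x =
    [set u | [set v | A (cons_pair (x, v))] (reset_tail j u) /\ B (tnth u j)]).
  rewrite IH//; congr (_ * _)%E; congr (cube_measure R p _).
  by apply/seteqP; split => u; rewrite /xsection/= inE/= rS.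
apply/seteqP; split => u; rewrite /xsection/= inE/= rS /cons_pair/=.
  by rewrite tnthS.
by rewrite tnthS.
Qed.

Lemma uniform01_cube p (i : 'I_p) :
  uniform01 (cube_measure R p) (fun u => tnth u i).
Proof.
split; first exact: measurable_tnth.
move=> B mB; have := cube_measure_reset_tail i measurableT mB.
rewrite preimage_setT probability_setT mul1e => <-.
by congr (cube_measure R p _); apply/seteqP; split => u //= [].
Qed.

End cube.

Lemma ae_inP d (T : measurableType d) (R : realType) (P : probability T R) (S : set T) :
  measurable S -> P S = 1%E -> {ae P, forall w, S w}.
Proof.
move=> mS S1; exists (~` S); split => //; first exact: measurableC.
by rewrite probability_setC// S1 subee.
Qed.

Lemma eq_prob_ae d (T : measurableType d) (R : realType) (P : probability T R)
    (A B : set T) : measurable A -> measurable B ->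
  {ae P, forall w, A w <-> B w} -> P A = P B.
Proof.
move=> mA mB [N [mN N0 sN]].
have key C D : measurable C -> measurable D -> (forall w, ~ N w -> C w -> D w) ->
    (P C <= P D)%E.
  move=> mC mD CD; apply: (@le_trans _ _ (P (D `|` N))).
    apply: le_measure; rewrite ?inE//; first exact: measurableU.
    by move=> w Cw; have [|Nw] := pselect (N w); [right|left; exact: CD].
  by rewrite -[leRHS]adde0 -N0; exact: measureU2.
have sAB w : ~ N w -> (A w <-> B w) by move=> Nw; apply: contrapT => /sN.
by apply/eqP; rewrite eq_le; apply/andP; split; apply: key => // w Nw;
  have [] := sAB w Nw.
Qed.

Section multivariate_quantile_transform.
Context (R : realType) (d : measure_display) (Om : measurableType d)
  (P : probability Om R) (p : nat) (X : {RV P >-> p.-tuple R})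
  (qX : p.-tuple R -> p.-tuple R).
Hypothesis mqtX : is_mqt X qX.

Local Notation cube := (cube_measure R p).

(** The recursion constrains [qX] on the open cube only; elsewhere it may fail to be measurable. A
    constant value off the open cube, a null set, repairs this. *)
Definition cube_extension (u : p.-tuple R) : p.-tuple R :=
  if `[< open_cube u >] then qX u else [tuple 0 | _ < p].

Local Notation qX' := cube_extension.

Lemma measurable_open_cube : measurable (@open_cube R p).
Proof.
rewrite (_ : @open_cube R p =
    \bigcap_(i in [set: 'I_p]) [set u | 0 < tnth u i < 1]); last first.
  apply/seteqP; split => u h i; first by move=> _; exact: h.
  exact: (h i).
apply: fin_bigcap_measurable; first exact: cardinality.finite_finset.
move=> i _; rewrite (_ : mkset _ = (fun u => tnth u i) @^-1` `]0, 1[%classic).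
  by apply: (measurable_preimageT (measurable_tnth i)).
by apply/seteqP; split => u /=; rewrite in_itv.
Qed.

Lemma cube_open_cube : {ae cube, forall u, open_cube u}.
Proof.
have key i : {ae cube, forall u : p.-tuple R, 0 < tnth u i < 1}.
  have : {ae cube, forall u, ((fun u => tnth u i) @^-1` `]0, 1[%classic) u}.
    apply: ae_inP; first by apply: (measurable_preimageT (measurable_tnth i)).
    have [_ ->//] := uniform01_cube R i.
    rewrite uniform_probE// setIidl; last first.
      by move=> x; rewrite /= !in_itv/= => /andP[/ltW -> /ltW ->].
    by rewrite lebesgue_measure_itv/= lte_fin ltr01 oppr0 adde0.
  by apply: filterS => u /=; rewrite in_itv.
(* The finitely many coordinates are treated as a countable family; for [n >= p] the condition is
   void. *)
have := @ae_foralln _ _ _ cube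
  (fun n (u : p.-tuple R) => forall h : (n < p)%N, 0 < tnth u (Ordinal h) < 1).
move=> /(_ _)/filterS; apply.
  move=> u hu i; have := hu i (ltn_ord i).
  by rewrite (_ : Ordinal _ = i)//; exact: val_inj.
move=> n; have [np|pn] := pselect (is_true (n < p)%N).
  apply: filterS (key (Ordinal np)) => u hu h.
  by rewrite (_ : Ordinal h = Ordinal np)//; exact: val_inj.
by apply: aeW => u h; case: (pn h).
Qed.

(** Induction along the recursion. The Galois connection rewrites the sublevel set of a coordinate
    at [y] as a comparison of [tnth u i] with [G i (prefix) y], so measurability of [G i] in the
    prefix at fixed [y] suffices. *)
Lemma measurable_cube_extension : measurable_fun setT qX'.
Proof.
have [G [cG qE]] := mqtX.
suff key (n : nat) (i : 'I_p) : (i < n)%N ->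
    measurable_fun setT (fun u => tnth (qX' u) i).
  by apply/measurable_fun_tnthP => i; exact: (key p i (ltn_ord i)).
elim: n i => // n IH i; rewrite ltnS => ilen.
have mpre : measurable_fun setT (fun u => prefix_tuple i (qX' u)).
  apply/measurable_fun_tnthP => j; rewrite /comp/=.
  apply: (eq_measurable_fun (fun u => tnth (qX' u) (widen_ord (ltnW (ltn_ord i)) j))).
    by move=> u _; rewrite tnth_mktuple.
  by apply: IH; rewrite /= (leq_trans (ltn_ord j)).
apply: measurable_fun_Iic => y.
have mG : measurable_fun setT (fun x => G i x y) by case: (cG i y).
rewrite (_ : mkset _ =
    (@open_cube R p `&` [set u | tnth u i <= G i (prefix_tuple i (qX' u)) y]) `|`
    (~` @open_cube R p `&` [set u | 0 <= y])); last first.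
  apply/seteqP; split => u /=.
    have [ou|nou] := pselect (open_cube u); rewrite /qX' ?(asboolT ou) ?(asboolF nou).
      by rewrite qE// (ginv_cumulative_le _ _ (ou i)); left.
    by rewrite tnth_mktuple; right.
  move=> [[ou]|[nou]]; rewrite /qX' ?(asboolT ou) ?(asboolF nou).
    by rewrite qE// (ginv_cumulative_le _ _ (ou i)).
  by rewrite tnth_mktuple.
apply: measurableU; apply: measurableI.
- exact: measurable_open_cube.
- apply: measurable_le_fun; first exact: measurable_tnth.
  exact: (measurableT_comp mG mpre).
- by apply: measurableC; exact: measurable_open_cube.
- have [y0|y0] := leP 0 y.
    by rewrite (_ : mkset _ = setT)//; apply/seteqP; split.
  by rewrite (_ : mkset _ = set0)//; apply/seteqP; split => // u /=; rewrite leNgt y0.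
Qed.

(** The transform is triangular: the recursion for a coordinate reads only the input at that index
    and the outputs before it. The filler stays in the open cube, where the recursion holds. *)
Lemma reset_tail_cube_extension (n : nat) (u : p.-tuple R) : open_cube u ->
  reset_tail n (qX' (reset_tail n u)) = reset_tail n (qX' u).
Proof.
have [G [cG qE]] := mqtX.
move=> ou; have or := open_cube_reset_tail n ou.
rewrite /qX' (asboolT ou) (asboolT or).
suff key (m : nat) (j : 'I_p) : (j < m)%N -> (j < n)%N ->
    tnth (qX (reset_tail n u)) j = tnth (qX u) j.
  apply: eq_from_tnth => j; rewrite !tnth_mktuple; case: ifP => // jn.
  exact: (key p).
elim: m j => // m IH j; rewrite ltnS => jm jn.
rewrite !qE// tnth_mktuple jn; congr (ginv (G j _) _).
apply: eq_from_tnth => k; rewrite !tnth_mktuple.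
by apply: IH; [exact: leq_trans (ltn_ord k) jm|exact: ltn_trans (ltn_ord k) jn].
Qed.

(** Rebuilds the first [n + 1] coordinates from the first [n] and the next one, so that the
    induction step on laws concerns a pair. *)
Definition merge_coordinate (n : nat) (x : p.-tuple R * R) : p.-tuple R :=
  [tuple if (j < n)%N then tnth x.1 j else if j == n :> nat then x.2 else 2^-1
  | j < p].

Lemma measurable_merge_coordinate n : measurable_fun setT (merge_coordinate n).
Proof.
apply/measurable_fun_tnthP => j; rewrite /comp/=.
have [jn|nj] := boolP (j < n)%N.
  apply: (eq_measurable_fun (fun z : p.-tuple R * R => tnth z.1 j)).
    by move=> z _; rewrite tnth_mktuple jn.
  exact: (measurableT_comp (measurable_tnth j) measurable_fst).
have [ejn|nejn] := boolP (j == n :> nat).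
  apply: (eq_measurable_fun (fun z : p.-tuple R * R => z.2)).
    by move=> z _; rewrite tnth_mktuple (negbTE nj) ejn.
  exact: measurable_snd.
rewrite (_ : (fun x => _) = cst 2^-1)//.
by apply/funext => z; rewrite tnth_mktuple (negbTE nj) (negbTE nejn).
Qed.

Lemma reset_tail_merge (i : 'I_p) (x : p.-tuple R) :
  reset_tail i.+1 x = merge_coordinate i (reset_tail i x, tnth x i).
Proof.
apply: eq_from_tnth => j; rewrite !tnth_mktuple/= ltnS leq_eqVlt.
case: ltnP => [ji|ij]; first by rewrite orbT.
rewrite orbF; case: eqP => // /val_inj -> //.
Qed.

(** In the induction step, the new coordinate is at most [y] exactly when [tnth u i] is at most
    [G i (prefix) y]. As [tnth u i] is uniform and independent of the prefix, the probability is an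
    integral of [G i] over the prefix; the induction hypothesis transfers it to [X], where it is the
    defining property of [G i]. *)
Lemma reset_tail_mqt_law (n : nat) (A : set (p.-tuple R)) : (n <= p)%N ->
  measurable A ->
  cube ((fun u => reset_tail n (qX' u)) @^-1` A) =
  P ((fun w => reset_tail n (X w)) @^-1` A).
Proof.
have [G [cG qE]] := mqtX.
elim: n A => [|n IH] A np mA.
  have r0 (u v : p.-tuple R) : reset_tail 0 u = reset_tail 0 v.
    by apply: eq_from_tnth => k; rewrite !tnth_mktuple.
  pose z : p.-tuple R := [tuple 0 | _ < p].
  have eA T (Z : T -> p.-tuple R) :
      (fun w => reset_tail 0 (Z w)) @^-1` A = [set _ | A (reset_tail 0 z)].
    by apply/funext => w; rewrite /preimage/mkset (r0 (Z w) z).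
  rewrite !eA; have [Az|Az] := pselect (A (reset_tail 0 z)).
    have eT T : [set _ : T | A (reset_tail 0 z)] = setT.
      by apply/seteqP; split.
    by rewrite !eT !probability_setT.
  have e0 T : [set _ : T | A (reset_tail 0 z)] = set0.
    by apply/seteqP; split.
  by rewrite !e0 !measure0.
pose i := Ordinal np.
have mr := @measurable_reset_tail R p.
have mq := measurable_cube_extension.
have mX : measurable_fun setT X by exact: measurable_funPT.
have mrq k : measurable_fun setT (fun u => reset_tail k (qX' u)).
  exact: measurableT_comp.
have mrX k : measurable_fun setT (fun w => reset_tail k (X w)).
  exact: measurableT_comp.
have mqi : measurable_fun setT (fun u => tnth (qX' u) i).
  exact: (measurableT_comp (measurable_tnth i) mq).
have mXi : measurable_fun setT (fun w => tnth (X w) i).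
  exact: (measurableT_comp (measurable_tnth i) mX).
have mM := measurable_preimageT (measurable_merge_coordinate n) mA.
have eM T (Z : T -> p.-tuple R) :
    (fun w => reset_tail n.+1 (Z w)) @^-1` A =
    [set w | (merge_coordinate n @^-1` A) (reset_tail n (Z w), tnth (Z w) i)].
  by apply/funext => w; rewrite /preimage/mkset (reset_tail_merge i).
rewrite !eM; apply: (law_unique_prod_ray (mrq n) (mrX n) mqi mXi _ _ mM).
  by move=> B mB; exact: IH (ltnW np) mB.
move=> {A mA mM eM} A y mA.
have mI d0 (T : measurableType d0) (Z : T -> R) : measurable_fun setT Z ->
    measurable [set w | Z w <= y].
  by move=> mZ; apply: measurable_le_fun.
have mG : measurable_fun setT (fun x => G i x y) by case: (cG i y).
(* Resetting the input first makes [W] a function of the coordinates before [i] on the whole cube,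
   hence independent of [tnth u i]; on the open cube it agrees with the output. *)
pose W u := reset_tail n (qX' (reset_tail n u)).
pose h (x : p.-tuple R) := G i (prefix_tuple i x) y.
have mpre : measurable_fun setT (@prefix_tuple R p i).
  apply/measurable_fun_tnthP => j; rewrite /comp/=.
  apply: (eq_measurable_fun (fun x : p.-tuple R =>
    tnth x (widen_ord (ltnW (ltn_ord i)) j))).
    by move=> u _; rewrite tnth_mktuple.
  exact: measurable_tnth.
have mh : measurable_fun setT h by exact: (measurableT_comp mG mpre).
have mW : measurable_fun setT W by exact: (measurableT_comp (mrq n) (mr n)).
have iW : independent cube W (fun u => tnth u i).
  move=> B C mB mC; have [_ uE] := uniform01_cube R i; rewrite uE//.
  by have := cube_measure_reset_tail i (measurable_preimageT (mrq n) mB) mC.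
have WE u : open_cube u -> W u = reset_tail n (qX' u).
  exact: reset_tail_cube_extension.
have h01 x : A x -> 0 <= h x <= 1 by move=> _; exact: cumulative01_range.
transitivity (cube (W @^-1` A `&` [set u | tnth u i <= h (W u)])).
  apply: eq_prob_ae.
  - by apply: measurableI; [exact: measurable_preimageT|exact: mI].
  - apply: measurableI; [exact: measurable_preimageT|apply: measurable_le_fun].
      exact: measurable_tnth.
    exact: measurableT_comp.
  - apply: filterS cube_open_cube => u ou.
    rewrite /preimage/setI/mkset/= WE// /h.
    rewrite (prefix_tuple_reset_tail i (qX' u)).
    rewrite /qX' (asboolT ou) qE// ginv_cumulative_le//; exact: ou.
rewrite (probability_uniform_le mW (uniform01_cube R i) iW mh mA h01).
have eWX B : measurable B -> cube (W @^-1` B) =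
    P ((fun w => reset_tail n (X w)) @^-1` B).
  move=> mB; rewrite -IH//; last exact: ltnW.
  apply: eq_prob_ae; [exact: measurable_preimageT|exact: measurable_preimageT|].
  by apply: filterS cube_open_cube => u ou; rewrite /preimage/mkset WE.
have := @ge0_integral_eq_law R _ _ _ _ _ _ cube P W (fun w => reset_tail n (X w))
  (EFin \o h) mW (mrX n) eWX => ->//; last 2 first.
- exact/measurable_EFinP.
- move=> x; rewrite lee_fin.
  by have /andP[] := cumulative01_range (G i (prefix_tuple i x)) y.
have [_ _ cE] := cG i y.
(* [G i] is a conditional probability given the prefix, so the event is pulled back to a set of
   prefixes. *)
have -> : (fun w => reset_tail n (X w)) @^-1` A =
    (fun w => prefix_tuple i (X w)) @^-1` (@embed_tuple R p n @^-1` A).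
  by apply/funext => w; rewrite /preimage/mkset (reset_tailE i).
have mB := measurable_preimageT (@measurable_embed_tuple R p n) mA.
transitivity (\int[P]_(w in (fun w => prefix_tuple i (X w)) @^-1`
    (@embed_tuple R p n @^-1` A)) (G i (prefix_tuple i (X w)) y)%:E)%E.
  by apply: eq_integral => w _; rewrite /= /h (prefix_tuple_reset_tail i).
have mXpre : measurable_fun setT (fun w => prefix_tuple i (X w)).
  exact: measurableT_comp.
rewrite (cE _ mB).
rewrite integral_indic; [by rewrite setIC|exact: measurable_preimageT mB|exact: mI].
Qed.

Lemma mqt_law (A : set (p.-tuple R)) : measurable A ->
  cube (qX' @^-1` A) = P (X @^-1` A).
Proof.
move=> mA; have := reset_tail_mqt_law (leqnn p) mA.
by rewrite /preimage; under eq_set do rewrite reset_tail_full;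
  under [in X in _ = X]eq_set do rewrite reset_tail_full.
Qed.

End multivariate_quantile_transform.

(** * Hinge functionals and conditional probabilities *)

Section hinge.
Context (R : realType).

Section one_space.
Context (d : measure_display) (Om : measurableType d) (P : probability Om R).

Definition hinge (h : Om -> R) (c : R) : R := \int[P]_w Num.max (h w - c) 0.

Lemma integrable_cst_probability (D : set Om) (c : R) : measurable D ->
  P.-integrable D (EFin \o (fun=> c)).
Proof. by move=> mD; exact: finite_measure_integrable_cst. Qed.

Lemma integrable_subr_cst (h : Om -> R) (c : R) :
  P.-integrable setT (EFin \o h) ->
  P.-integrable setT (EFin \o (fun w => h w - c)).
Proof.
move=> ih; have := integrableB measurableT ih (integrable_cst_probability c measurableT).
by apply: eq_integrable => // w _; rewrite /= EFinB.
Qed.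

Lemma integrable_max0 (h : Om -> R) (c : R) :
  P.-integrable setT (EFin \o h) ->
  P.-integrable setT (EFin \o (fun w => Num.max (h w - c) 0)).
Proof.
move=> ih.
have ihc := integrable_subr_cst c ih.
have mhc : measurable_fun setT (fun w => h w - c).
  by apply/measurable_EFinP; exact: measurable_int ihc.
apply: le_integrable ihc => //.
  by apply/measurable_EFinP; exact: measurable_maxr.
move=> w _ /=; rewrite lee_fin ger0_norm ?le_max ?lexx ?orbT//.
by rewrite ge_max ler_norm normr_ge0.
Qed.

Lemma eq_Rintegral_ae (D : set Om) (f g : Om -> R) : measurable D ->
  measurable_fun setT f -> measurable_fun setT g ->
  {ae P, forall w, D w -> f w = g w} ->
  \int[P]_(w in D) f w = \int[P]_(w in D) g w.
Proof.
move=> mD mf mg fg; congr fine; apply: ae_eq_integral => //.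
- by apply: measurable_funTS; exact/measurable_EFinP.
- by apply: measurable_funTS; exact/measurable_EFinP.
- by apply: filterS fg => w fg Dw; rewrite fg.
Qed.

Lemma RintegralBcst (D : set Om) (h : Om -> R) (c : R) : measurable D ->
  P.-integrable setT (EFin \o h) ->
  \int[P]_(w in D) (h w - c) = \int[P]_(w in D) h w - c * fine (P D).
Proof.
move=> mD ih; rewrite RintegralB ?Rintegral_cst//.
  exact: integrableS ih.
exact: integrable_cst_probability.
Qed.

Lemma Rintegral_restrict (D : set Om) (f : Om -> R) :
  \int[P]_(w in D) f w = \int[P]_w (\1_D w * f w).
Proof.
rewrite Rintegral_mkcond; apply: eq_Rintegral => w _.
by rewrite patchE indicE; case: ifP => _; rewrite (mul1r, mul0r).
Qed.

Lemma integrable_indicM (D : set Om) (f : Om -> R) : measurable D ->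
  P.-integrable setT (EFin \o f) ->
  P.-integrable setT (EFin \o (fun w => \1_D w * f w)).
Proof.
move=> mD fi; have : P.-integrable setT ((EFin \o f) \_ D).
  by apply/(integrable_mkcond _ mD); exact: integrableS fi.
apply: eq_integrable => // w _; rewrite patchE /= indicE.
by case: ifP => _; rewrite (mul1r, mul0r).
Qed.

(** Half of a variational formula: E(h - c)^+ is the maximum over events [D] of E[h - c; D]. Most
    inequalities below arise by choosing [D]. *)
Lemma hinge_ge (h : Om -> R) (c : R) (D : set Om) : measurable D ->
  P.-integrable setT (EFin \o h) ->
  \int[P]_(w in D) h w - c * fine (P D) <= hinge h c.
Proof.
move=> mD ih; rewrite -RintegralBcst// Rintegral_restrict; apply: le_Rintegral => //.
- by apply: integrable_indicM => //; exact: integrable_subr_cst.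
- exact: integrable_max0.
- move=> w _; rewrite indicE; case: (w \in D).
    by rewrite mul1r le_max lexx.
  by rewrite mul0r le_max lexx orbT.
Qed.

(** The defect is the integral of the nonnegative [k], so optimality of [D] means [k = 0] a.s.: up
    to null sets, [D] lies between [c < h] and [c <= h]. The a.s. identities between conditional
    probabilities come from here. *)
Lemma hinge_eqP (h : Om -> R) (c : R) (D : set Om) : measurable D ->
  P.-integrable setT (EFin \o h) ->
  (hinge h c = \int[P]_(w in D) h w - c * fine (P D)) <->
  {ae P, forall w, (D w -> c <= h w) /\ (~ D w -> h w <= c)}.
Proof.
move=> mD ih.
have ihc := integrable_subr_cst c ih.
have im := integrable_max0 c ih; have iD := integrable_indicM mD ihc.
pose k w := Num.max (h w - c) 0 - \1_D w * (h w - c).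
have ik : P.-integrable setT (EFin \o k).
  have := integrableB measurableT im iD.
  by apply: eq_integrable => // w _; rewrite /= EFinB.
have k0 w : 0 <= k w.
  rewrite /k indicE; case: (w \in D).
    by rewrite mul1r subr_ge0 le_max lexx.
  by rewrite mul0r subr0 le_max lexx orbT.
have hk : hinge h c - (\int[P]_(w in D) h w - c * fine (P D)) = \int[P]_w k w.
  by rewrite -RintegralBcst// Rintegral_restrict -RintegralB.
have kE w : k w = 0 <-> (D w -> c <= h w) /\ (~ D w -> h w <= c).
  rewrite /k indicE; have [wD|wD] := pselect (D w).
    rewrite mem_set// mul1r; split => [/eqP|[/(_ wD) ch _]].
      by rewrite subr_eq0 eq_maxl subr_ge0 => ch; split.
    by apply/eqP; rewrite subr_eq0 eq_maxl subr_ge0.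
  rewrite memNset// mul0r subr0; split => [/eqP|[_ /(_ wD) ch]].
    by rewrite eq_maxr subr_le0 => ch; split.
  by apply/eqP; rewrite eq_maxr subr_le0.
split => [/eqP|kae].
  rewrite -subr_eq0 hk => /eqP ik0.
  have : (\int[P]_w `|(k w)%:E| = 0)%E.
    under eq_integral do rewrite gee0_abs ?lee_fin//.
    (* [fine] also sends infinite values to 0; integrability excludes them. *)
    have := integrable_fin_num measurableT ik; rewrite fin_numE.
    by move: ik0; rewrite /Rintegral; case: (integral _ _ _) => //= r ->.
  move/(ae_eq_integral_abs _ measurableT); move=> /(_ (measurable_int _ ik)).
  by apply: filterS => w /(_ I) kw0; apply/kE; case: kw0.
apply/eqP; rewrite -subr_eq0 hk.
rewrite (@eq_Rintegral_ae _ k (fun=> 0))// ?Rintegral_cst ?mul0r//.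
  by apply/measurable_EFinP; exact: measurable_int ik.
by apply: filterS kae => w /kE.
Qed.

Lemma hinge_super (h : Om -> R) (c : R) : P.-integrable setT (EFin \o h) ->
  hinge h c = \int[P]_(w in [set w | c < h w]) h w
              - c * fine (P [set w | c < h w]).
Proof.
move=> ih; have mh : measurable_fun setT h.
  by apply/measurable_EFinP; exact: measurable_int ih.
apply/hinge_eqP => //.
  rewrite (_ : mkset _ = ~` [set w | h w <= c]); last first.
    by apply/seteqP; split => w /=; rewrite real_ltNge ?num_real//; move/negP.
  by apply: measurableC; exact: measurable_le_fun.
by apply: aeW => w; split => /= [/ltW//|/negP]; rewrite -leNgt.
Qed.

Lemma hinge_ae (h h' : Om -> R) (c : R) :
  measurable_fun setT h -> measurable_fun setT h' ->
  {ae P, forall w, h w = h' w} -> hinge h c = hinge h' c.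
Proof.
move=> mh mh' hh'; apply: eq_Rintegral_ae => //.
- by apply: measurable_maxr => //; exact: measurable_funB.
- by apply: measurable_maxr => //; exact: measurable_funB.
- by apply: filterS hh' => w -> _.
Qed.

End one_space.

Lemma hinge_eq_law d1 d2 (Om1 : measurableType d1) (Om2 : measurableType d2)
    (P1 : probability Om1 R) (P2 : probability Om2 R)
    (h1 : Om1 -> R) (h2 : Om2 -> R) (c : R) :
  measurable_fun setT h1 -> measurable_fun setT h2 ->
  (forall A, measurable A -> P1 (h1 @^-1` A) = P2 (h2 @^-1` A)) ->
  hinge P1 h1 c = hinge P2 h2 c.
Proof.
move=> mh1 mh2 eh; congr fine.
have := @ge0_integral_eq_law R _ _ _ _ _ _ P1 P2 h1 h2
  (fun x => (Num.max (x - c) 0)%:E) mh1 mh2 eh.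
move=> /(_ _ _ setT); rewrite !preimage_setT; apply => //.
- by apply/measurable_EFinP; apply: measurable_maxr => //; exact: measurable_funB.
- by move=> x; rewrite lee_fin le_max lexx orbT.
Qed.

End hinge.

Section conditional_probability.
Context (R : realType) (d : measure_display) (Om : measurableType d)
  (P : probability Om R).

Section versions.
Context d' (E : measurableType d') (X : Om -> E) (A : set Om).
Hypotheses (mX : measurable_fun setT X) (mA : measurable A).

Lemma is_cond_probP (g : E -> R) : is_cond_prob P A X g <->
  [/\ measurable_fun setT g, P.-integrable setT (EFin \o (g \o X)) &
      forall B, measurable B ->
        (\int[P]_(w in X @^-1` B) (g (X w))%:E = P (A `&` X @^-1` B))%E].
Proof.
have e B : measurable B ->
    (\int[P]_(w in X @^-1` B) (\1_A w)%:E = P (A `&` X @^-1` B))%E.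
  by move=> mB; rewrite integral_indic//; exact: measurable_preimageT mB.
by split => -[mg ig gE]; split => // B mB; rewrite gE// e.
Qed.

Lemma cond_prob_Rintegral (g : E -> R) (B : set E) : is_cond_prob P A X g ->
  measurable B ->
  \int[P]_(w in X @^-1` B) g (X w) = fine (P (A `&` X @^-1` B)).
Proof. by move=> /is_cond_probP[_ _ gE] mB; rewrite /Rintegral gE. Qed.

End versions.

Lemma is_cond_prob_id (A : set Om) : measurable A ->
  is_cond_prob P A id (\1_A : Om -> R).
Proof.
by move=> mA; split; [exact: measurable_indic|exact: integrable_indic|].
Qed.

Section refinement.
Context d1 d2 (E1 : measurableType d1) (E2 : measurableType d2)
  (X1 : Om -> E1) (X2 : Om -> E2) (A : set Om) (g1 : E1 -> R) (g2 : E2 -> R).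
Hypotheses (mX1 : measurable_fun setT X1) (mX2 : measurable_fun setT X2)
  (mA : measurable A)
  (sX : forall B, measurable B ->
     exists2 B', measurable B' & X1 @^-1` B = X2 @^-1` B')
  (cg1 : is_cond_prob P A X1 g1) (cg2 : is_cond_prob P A X2 g2).

(** The optimal event [c < g1 (X1)] is an event of both vectors, so [g1 (X1)] and [g2 (X2)] have the
    same integral over it. With [hinge_ge] for [g2], this is the conditional Jensen inequality. *)
Let hinge_coarse (c : R) :
  hinge P (g1 \o X1) c =
  \int[P]_(w in [set w | c < g1 (X1 w)]) g2 (X2 w)
  - c * fine (P [set w | c < g1 (X1 w)]).
Proof.
have [mg1 ig1 _] := cg1; rewrite hinge_super//; congr (_ - _).
have mB : measurable [set x | c < g1 x] by exact: measurable_lt_fun.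
have := cond_prob_Rintegral mX1 mA cg1 mB; have [B' mB' eB] := sX mB.
by rewrite eB -(cond_prob_Rintegral mX2 mA cg2 mB') -eB.
Qed.

Let mD (c : R) : measurable [set w | c < g1 (X1 w)].
Proof.
have [mg1 _ _] := cg1; apply: measurable_lt_fun => //.
exact: (measurableT_comp mg1 mX1).
Qed.

Lemma hinge_refinement (c : R) : hinge P (g1 \o X1) c <= hinge P (g2 \o X2) c.
Proof. by rewrite hinge_coarse; apply: hinge_ge; [exact: mD|case: cg2]. Qed.

(* Wherever a rational [c] separates [g1 (X1)] from [g2 (X2)], Jensen's
   inequality for the hinge with kink [c] is strict. *)
Lemma hinge_refinement_eq :
  (forall c, hinge P (g2 \o X2) c <= hinge P (g1 \o X1) c) ->
  {ae P, forall w, g1 (X1 w) = g2 (X2 w)}.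
Proof.
move=> h21.
(* If the hinges agree, the event that is optimal for [g1 (X1)] is optimal for [g2 (X2)] as well. *)
have key (c : R) : {ae P, forall w, (c < g1 (X1 w) -> c <= g2 (X2 w)) /\
    (~ c < g1 (X1 w) -> g2 (X2 w) <= c)}.
  apply/(hinge_eqP c (mD c)); first by case: cg2.
  by apply/eqP; rewrite eq_le -hinge_coarse h21 hinge_refinement.
(* [unpickle] enumerates the rationals, so that one null set serves all of them; integers that code
   none are sent to 0. *)
have : {ae P, forall w, forall n : nat, let c := ratr (odflt 0 (unpickle n)) : R in
    (c < g1 (X1 w) -> c <= g2 (X2 w)) /\ (~ c < g1 (X1 w) -> g2 (X2 w) <= c)}.
  by apply: ae_foralln => n; exact: key.
apply: filterS => w hw; apply/eqP; rewrite eq_le.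
apply/andP; split; rewrite leNgt; apply/negP.
  move=> /rat_in_itvoo[r]; rewrite in_itv/= => /andP[r1 r2].
  have := hw (pickle r); rewrite pickleK/= => -[/(_ r2) r3 _].
  by have := lt_le_trans r1 r3; rewrite ltxx.
move=> /rat_in_itvoo[r]; rewrite in_itv/= => /andP[r1 r2].
have := hw (pickle r); rewrite pickleK/= => -[_ r3].
have /r3 r4 : ~ ratr r < g1 (X1 w) by apply/negP; rewrite -leNgt ltW.
by have := lt_le_trans r2 r4; rewrite ltxx.
Qed.

End refinement.

Section versions2.
Context d' (E : measurableType d') (X : Om -> E) (A : set Om).
Hypotheses (mX : measurable_fun setT X) (mA : measurable A).

(** A vector refines itself, so the hinge inequality holds in both directions and its equality case
    applies. *)
Lemma cond_prob_unique (g g' : E -> R) : is_cond_prob P A X g ->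
  is_cond_prob P A X g' -> {ae P, forall w, g (X w) = g' (X w)}.
Proof.
move=> cg cg'; have sX B : measurable B ->
  exists2 B', measurable B' & X @^-1` B = X @^-1` B' by exists B.
apply: (hinge_refinement_eq mX mX mA sX cg cg') => c.
exact: (hinge_refinement mX mX mA sX cg' cg).
Qed.

Lemma is_cond_prob_ae (g g' : E -> R) : is_cond_prob P A X g ->
  measurable_fun setT g' -> {ae P, forall w, g (X w) = g' (X w)} ->
  is_cond_prob P A X g'.
Proof.
move=> [mg ig gE] mg' gg'.
have aB B : ae_eq P B (EFin \o (g' \o X)) (EFin \o (g \o X)).
  by apply: filterS gg' => w /= -> _.
have mgX : measurable_fun setT (EFin \o (g' \o X)).
  by apply/measurable_EFinP; exact: measurableT_comp.
split => //.
  apply/integrableP; split => //; have /integrableP[mgX' ] := ig.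
  congr (_ < _)%E; apply: ae_eq_integral => //;
    [exact: measurableT_comp|exact: measurableT_comp|].
  by apply: filterS gg' => w /= -> _.
move=> B mB; rewrite -gE//.
have mXB := measurable_preimageT mX mB.
apply: (ae_eq_integral (EFin \o (g \o X))) => //; apply: measurable_funTS => //.
exact: measurable_int ig.
Qed.

Lemma cond_prob_expectation (g : E -> R) : is_cond_prob P A X g ->
  \int[P]_w g (X w) = fine (P A).
Proof.
move=> cg; have := cond_prob_Rintegral mX mA cg measurableT.
by rewrite preimage_setT setIT.
Qed.

(** The indicator of [A] is the conditional probability given the full information [id], so its
    hinges dominate. At 0 its hinge is the common mean and at 1 it vanishes; hence [setT] and [set0]
    are optimal for [g (X)], which gives the two bounds. *)
Lemma cond_prob_range (g : E -> R) : is_cond_prob P A X g ->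
  {ae P, forall w, 0 <= g (X w) <= 1}.
Proof.
move=> cg; have [mg ig _] := cg.
have sX B : measurable B -> exists2 B', measurable B' & X @^-1` B = id @^-1` B'.
  by move=> mB; exists (X @^-1` B) => //; exact: measurable_preimageT mB.
have H c := hinge_refinement mX (@measurable_id _ _ setT) mA sX cg (is_cond_prob_id mA) c.
have h0 : hinge P (g \o X) 0 = \int[P]_(w in setT) g (X w) - 0 * fine (P setT).
  apply/eqP; rewrite eq_le hinge_ge// andbT (le_trans (H 0))//.
  rewrite (cond_prob_expectation cg) mul0r subr0 /hinge.
  under eq_Rintegral do rewrite subr0 max_l//.
  by rewrite /Rintegral integral_indic// setIT.
have h1 : hinge P (g \o X) 1 = \int[P]_(w in set0) g (X w) - 1 * fine (P set0).
  apply/eqP; rewrite eq_le hinge_ge// andbT (le_trans (H 1))//.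
  rewrite Rintegral_set0 measure0 mulr0 subr0 /hinge.
  under eq_Rintegral => w _ do rewrite max_r ?subr_le0 ?indicE ?lern1 ?leq_b1//.
  by rewrite Rintegral_cst// mul0r.
move/(hinge_eqP _ measurableT ig): h0; move/(hinge_eqP _ measurable0 ig): h1.
by apply: filterS2 => w /= [_ +] [+ _] => /(_ (fun x => x)) -> /(_ I) ->.
Qed.

(** Pulling a factor out requires the bounds at every point, not only a.s. *)
Lemma cond_prob_clip (g : E -> R) : is_cond_prob P A X g ->
  exists g', is_cond_prob P A X g' /\ forall x, 0 <= g' x <= 1.
Proof.
move=> cg; have [mg _ _] := cg.
exists (fun x => Num.min (Num.max (g x) 0) 1); split; last first.
  by move=> x; rewrite le_min ge_min lexx orbT ler01 le_max lexx orbT.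
apply: (is_cond_prob_ae cg).
  by apply: measurable_minr => //; exact: measurable_maxr.
apply: filterS (cond_prob_range cg) => w /andP[g0 g1].
by rewrite max_l// min_l.
Qed.

Lemma is_cond_prob_setC (g : E -> R) : is_cond_prob P A X g ->
  is_cond_prob P (~` A) X (fun x => 1 - g x).
Proof.
move=> cg; have [mg ig _] := cg.
have ig1 : P.-integrable setT (EFin \o ((fun x => 1 - g x) \o X)).
  have := integrableB measurableT (integrable_cst_probability P 1 measurableT) ig.
  by apply: eq_integrable => // w _; rewrite /= EFinB.
apply/is_cond_probP => //; first exact: measurableC.
split=> //; first exact: measurable_funB.
move=> B mB; have mXB := measurable_preimageT mX mB.
under eq_integral do rewrite EFinB.
rewrite integralB_EFin//; last 2 first.
- exact: integrable_cst_probability.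
- exact: integrableS ig.
have [_ _ ->//] := (is_cond_probP mX mA g).1 cg.
rewrite integral_cst// mul1e (_ : ~` A `&` _ = X @^-1` B `\` A); last first.
  by rewrite setDE setIC.
by rewrite measureD// 1?setIC// ltey_eq fin_num_measure.
Qed.

Lemma is_cond_prob_ae_event (A' : set Om) (g : E -> R) : measurable A' ->
  P (A `\` A') = 0%E -> P (A' `\` A) = 0%E ->
  is_cond_prob P A X g -> is_cond_prob P A' X g.
Proof.
move=> mA' AA' A'A /(is_cond_probP mX mA)[mg ig gE].
apply/(is_cond_probP mX mA'); split => // B mB; rewrite gE//.
have mXB := measurable_preimageT mX mB.
apply: eq_prob_ae; [exact: measurableI|exact: measurableI|].
exists ((A `\` A') `|` (A' `\` A)); split.
- by apply: measurableU; exact: measurableD.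
- rewrite measureU0 ?AA' ?A'A//; exact: measurableD.
- move=> w /= nw; apply: contrapT => nw'; apply: nw.
  have [Aw|nAw] := pselect (A w); have [A'w|nA'w] := pselect (A' w); try tauto.
Qed.

End versions2.

End conditional_probability.

Section restricted_law.
Context (R : realType) (d d' : measure_display) (Om : measurableType d)
  (E : measurableType d') (P : probability Om R) (X : {RV P >-> E})
  (A : set Om) (mA : measurable A).

Definition restricted_law : set E -> \bar R := pushforward (mrestr P mA) X.

Let law0 : restricted_law set0 = 0%E.
Proof. exact: measure0. Qed.

Let law_ge0 B : (0 <= restricted_law B)%E.
Proof. exact: measure_ge0. Qed.

Let law_sigma_additive : semi_sigma_additive restricted_law.
Proof. exact: measure_semi_sigma_additive. Qed.

HB.instance Definition _ := isMeasure.Build _ _ _ restricted_law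
  law0 law_ge0 law_sigma_additive.

Lemma restricted_lawE B : restricted_law B = P (A `&` X @^-1` B).
Proof. by rewrite /restricted_law /pushforward /mrestr/= setIC. Qed.

Let law_fin : fin_num_fun restricted_law.
Proof.
move=> B mB; rewrite restricted_lawE fin_num_measure//.
by apply: measurableI => //; exact: measurable_funPTI.
Qed.

HB.instance Definition _ := Measure_isFinite.Build _ _ _ restricted_law law_fin.

(** The Radon-Nikodym density of the law of [X] restricted to [A] with respect to the law of [X]:
    taken on [E], it is directly a function of the value of [X]. *)
Lemma cond_prob_exists : exists g, is_cond_prob P A X g.
Proof.
have mX : measurable_fun setT X by exact: measurable_funPT.
pose nu : {finite_measure set E -> \bar R} := restricted_law.
pose mu : {finite_measure set E -> \bar R} := distribution P X.
have numu : nu `<< mu.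
  apply/null_content_dominatesP => B mB B0; apply/eqP; rewrite -measure_le0 -B0 /nu.
  rewrite [leLHS]restricted_lawE; apply: le_measure; rewrite ?inE.
  - by apply: measurableI => //; exact: measurable_preimageT mB.
  - exact: measurable_preimageT mB.
  - by move=> w [].
have fin := @Radon_Nikodym_SigmaFinite.f_fin_num _ _ _ nu mu numu.
have int := @Radon_Nikodym_SigmaFinite.f_integrable _ _ _ nu mu numu.
have ge0 := @Radon_Nikodym_SigmaFinite.f_ge0 _ _ _ nu mu numu.
have fE := @Radon_Nikodym_SigmaFinite.f_integral _ _ _ nu mu numu.
set f := Radon_Nikodym_SigmaFinite.f nu mu in fin int ge0 fE.
have mf : measurable_fun setT f by exact: measurable_int int.
have ef : EFin \o (fine \o f) = f by apply/funext => x; rewrite /= fineK.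
have pE B : measurable B ->
    (\int[P]_(w in X @^-1` B) (fine (f (X w)))%:E = P (A `&` X @^-1` B))%E.
  move=> mB; rewrite -restricted_lawE -[RHS]/(nu B) fE//.
  rewrite ge0_integral_pushforward//; last exact: measurable_funTS.
  by apply: eq_integral => w _; rewrite /= fineK.
exists (fine \o f); apply/is_cond_probP => //; split => //.
- by apply/measurable_EFinP; rewrite ef.
- apply/integrableP; split.
    apply/measurable_EFinP; apply: measurableT_comp => //.
    by apply/measurable_EFinP; rewrite ef.
  have := pE _ measurableT; rewrite preimage_setT setIT => pT.
  under eq_integral do rewrite gee0_abs ?lee_fin ?fine_ge0 ?ge0//.
  by rewrite pT ltey_eq fin_num_measure.
Qed.

End restricted_law.

Section pull_out.
Context (R : realType) (d d' : measure_display) (Om : measurableType d)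
  (E : measurableType d') (P : probability Om R).

(** [l] is the integral over [t] in [0,1] of the indicator of [t <= l]. The factor [l] thus becomes
    a family of events, which reduces products to integrals over sets. *)
Lemma integral_layer_cake (l f : Om -> R) (D : set Om) : measurable D ->
  measurable_fun setT l -> (forall w, 0 <= l w <= 1) ->
  measurable_fun setT f -> (forall w, 0 <= f w) ->
  (\int[P]_(w in D) (l w * f w)%:E =
   \int[unif R]_t \int[P]_(w in D `&` [set w | t <= l w]%R) (f w)%:E)%E.
Proof.
move=> mD ml l01 mf f0.
pose C := [set x : Om * measurableTypeR R | D x.1 /\ x.2 <= l x.1].
have mC : measurable C.
  apply: (@measurableI _ _ (fst @^-1` D) [set x : Om * measurableTypeR R | x.2 <= l x.1]).
    exact: measurable_preimageT.
  by apply: measurable_le_fun => //; exact: measurableT_comp.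
pose k (x : Om * measurableTypeR R) := (\1_C x * f x.1)%:E.
have mk : measurable_fun setT k.
  by apply/measurable_EFinP; apply: measurable_funM => //; exact: measurableT_comp.
have k0 x : (0 <= k x)%E by rewrite lee_fin mulr_ge0.
have := @fubini_tonelli _ _ _ _ R P (unif R) k mk k0.
have -> : (\int[P]_w \int[unif R]_t k (w, t) = \int[P]_(w in D) (l w * f w)%:E)%E.
  rewrite [RHS]integral_mkcond; apply: eq_integral => w _.
  rewrite /= patchE; case: ifPn => wD; last first.
    rewrite integral0_eq// => t _; rewrite /k indicE memNset ?mul0r//.
    by move: wD; rewrite notin_setE /= => wD [].
  move: wD; rewrite inE /= => wD.
  have -> : (\int[unif R]_t k (w, t) =
      \int[unif R]_t ((f w)%:E * (\1_(`]-oo, l w]%classic) t)%:E))%E.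
    apply: eq_integral => t _; rewrite /k EFinM muleC; congr (_ * _)%E.
    by rewrite !indicE; congr (_ _)%:E; congr nat_of_bool; apply/idP/idP;
      rewrite !inE/= in_itv/= /C/=; [case|].
  rewrite ge0_integralZl//; last 2 first.
  - by apply/measurable_EFinP; exact: measurable_indic.
  - by rewrite lee_fin.
  rewrite integral_indic// setIT muleC EFinM; congr (_ * _)%E.
  exact: uniform_prob_Iic.
move=> ->; apply: eq_integral => t _; rewrite [RHS]integral_mkcond.
apply: eq_integral => w _; rewrite patchE /k indicE /= /C/=.
have [h|h] := boolP (w \in _).
  by move: h; rewrite inE /= => h; rewrite mem_set// mul1r.
by move: h; rewrite notin_setE /= => h; rewrite memNset// mul0r.
Qed.

(** The layers [t <= l (X)] are events of [X], so the defining property of [g] applies to each of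
    them. The layer-cake formula is used on both sides, on the right with the second factor 1. *)
Lemma cond_prob_pull_out (X : Om -> E) (A : set Om) (g l : E -> R) (D : set E) :
  measurable_fun setT X -> measurable A -> measurable D ->
  is_cond_prob P A X g -> (forall x, 0 <= g x) ->
  measurable_fun setT l -> (forall x, 0 <= l x <= 1) ->
  (\int[P]_(w in X @^-1` D) (l (X w) * g (X w))%:E =
   \int[P]_(w in A `&` X @^-1` D) (l (X w))%:E)%E.
Proof.
move=> mX mA mD cg g0 ml l01; have [mg ig _] := cg.
have mXD := measurable_preimageT mX mD.
have mlX : measurable_fun setT (l \o X) by exact: measurableT_comp.
have mgX : measurable_fun setT (g \o X) by exact: measurableT_comp.
rewrite (integral_layer_cake (l := l \o X) (f := g \o X))//; last 2 first.
- by move=> w; exact: l01.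
- by move=> w; exact: g0.
under [RHS]eq_integral do rewrite -[l _]mulr1.
rewrite (integral_layer_cake (l := l \o X) (f := fun=> 1))//; last 2 first.
- exact: measurableI.
- by move=> w; exact: l01.
have [_ _ gE] := (is_cond_probP P mX mA g).1 cg.
apply: eq_integral => t _.
have mB : measurable (D `&` [set x | t <= l x]).
  by apply: measurableI => //; exact: measurable_le_fun.
have := gE _ mB; rewrite /preimage => ->.
rewrite integral_cst ?mul1e; first by rewrite -setIA.
apply: measurableI; first exact: measurableI.
exact: measurable_le_fun.
Qed.

End pull_out.

(** * Stochastically increasing pairs *)

Lemma le_of_lt_between (R : realFieldType) (x t u : R) : t < u ->
  (forall s, t < s -> s < u -> x <= s) -> x <= t.
Proof.
move=> tu h; rewrite leNgt; apply/negP => tx.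
have [xu|ux] := ltP x u.
  have := h ((t + x) / 2); rewrite midf_lt// (lt_trans _ xu) ?midf_lt//.
  by move=> /(_ isT isT); rewrite leNgt midf_lt.
have := h ((t + u) / 2); rewrite !midf_lt// => /(_ isT isT) xle.
by have := le_lt_trans xle (midf_lt tu).2; rewrite ltNge ux.
Qed.

Section uniform.
Context (R : realType) (d : measure_display) (Om : measurableType d)
  (P : probability Om R).

Lemma uniform01_Iic (U : Om -> R) (s : R) : uniform01 P U -> 0 <= s <= 1 ->
  P [set w | U w <= s] = s%:E.
Proof.
by move=> [mU lU] s01; rewrite -uniform_prob_Iic// -lU.
Qed.

Lemma uniform01_set1 (U : Om -> R) (s : R) : uniform01 P U ->
  P [set w | U w = s] = 0%E.
Proof.
move=> [mU lU]; have := lU [set s] (measurable_set1 s).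
rewrite uniform_probE// => ->; apply/eqP; rewrite -measure_le0.
rewrite -(lebesgue_measure_set1 s); apply: le_measure; rewrite ?inE//.
exact: measurableI.
Qed.

Lemma uniform01_cdf (U : Om -> R) : measurable_fun setT U ->
  (forall s, 0 < s < 1 -> P [set w | U w <= s] = s%:E) -> uniform01 P U.
Proof.
move=> mU hU; split => // A mA.
have mUs (s : R) : measurable [set w | U w <= s] by exact: measurable_le_fun.
apply: (law_unique_ray (P2 := unif R) mU (@measurable_id _ _ setT) _ mA) => y.
have -> : [set w : R | w <= y] = `]-oo, y]%classic by rewrite -preimage_Iic.
rewrite -[RHS]/(unif R `]-oo, y]).
have mono (x z : R) : x <= z -> (P [set w | (U w <= x)%R] <= P [set w | (U w <= z)%R])%E.
  by move=> xz; apply: le_measure; rewrite ?inE// => w /= /le_trans; apply.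
have [y0|y0] := leP y 0.
  have -> : unif R `]-oo, y] = 0%E.
    apply/eqP; rewrite -measure_le0.
    apply: (@le_trans _ _ (unif R `]-oo, 0])); last first.
      by rewrite uniform_prob_Iic// lexx ler01.
    by apply: le_measure; rewrite ?inE//; apply: subitvPr; rewrite bnd_simp.
  have fP : P [set w | U w <= y] \is a fin_num by exact: fin_num_measure.
  rewrite -[LHS](fineK fP); congr (_%:E); apply/eqP; rewrite eq_le fine_ge0// andbT.
  apply: (@le_of_lt_between _ _ 0 1) => // s s0 s1; rewrite -lee_fin fineK//.
  by rewrite -hU ?s0//; apply: mono; rewrite (le_trans y0)// ltW.
have [y1|y1] := ltP y 1; first by rewrite hU ?y0// uniform_prob_Iic// !ltW.
have -> : unif R `]-oo, y] = 1%E.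
  apply/eqP; rewrite eq_le probability_le1//=.
  apply: (@le_trans _ _ (unif R `]-oo, 1])).
    by rewrite uniform_prob_Iic// lexx ler01.
  by apply: le_measure; rewrite ?inE//; apply: subitvPr; rewrite bnd_simp.
have fP : P [set w | U w <= y] \is a fin_num by exact: fin_num_measure.
(* [le_of_lt_between] approximates from the right, whereas level 1 is reached from the left; hence
   the change of sign. *)
apply/eqP; rewrite eq_le probability_le1//= -[leRHS](fineK fP) lee_fin -lerN2.
apply: (@le_of_lt_between _ _ _ 0) => [|s s1 s0]; first by lra.
rewrite lerNl -lee_fin fineK// -(hU (- s)); last by lra.
by apply: mono; lra.
Qed.

End uniform.

Section stochastic_monotonicity.
Context (R : realType) (d : measure_display) (Om : measurableType d)
  (Q : probability Om R) (U V : Om -> R) (tau : R * R -> R).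
Hypotheses (mU : measurable_fun setT U) (uV : uniform01 Q V)
  (iUV : independent Q U V) (measurable_tau : measurable_fun setT tau)
  (tau_range : forall x, 0 <= tau x <= 1)
  (tau_nd : forall u v t, u <= v -> tau (u, t) <= tau (v, t)).

(* A nondecreasing [f : R -> R] is bounded on [0, 1], the range of [tau]: this
   is what makes a version that is increasing on all of [R] possible. *)
Lemma stoch_increasing_tau : stoch_increasing Q (fun w => tau (U w, V w)) U.
Proof.
have mV : measurable_fun setT V by case: uV.
move=> f ndf _.
(* Subtracting [f 0] makes the integrand nonnegative for Tonelli's theorem; the witness adds it back
   to [G]. *)
pose k x := f (tau x) - f 0.
have mf : measurable_fun setT f by apply: nondecreasing_measurable => //.
have mk : measurable_fun setT k.
  by apply: measurable_funB => //; exact: measurableT_comp.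
have k0 x : 0 <= k x by rewrite subr_ge0; apply: ndf; have /andP[] := tau_range x.
have k1 x : k x <= f 1 - f 0.
  by rewrite lerD2r; apply: ndf; have /andP[] := tau_range x.
pose G u := \int[unif R]_t k (u, t).
have mku u : measurable_fun setT (fun t : measurableTypeR R => k (u, t)).
  by apply: (measurableT_comp mk); exact: pair1_measurable.
have iku u : (unif R).-integrable setT (EFin \o (fun t => k (u, t))).
  apply: (le_integrable measurableT _ _
    (integrable_cst_probability (unif R) (f 1 - f 0) measurableT)).
    exact/measurable_EFinP.
  move=> t _; rewrite /= lee_fin !ger0_norm// ?k1//.
  exact: le_trans (k0 (u, t)) (k1 (u, t)).
have ndG : {homo G : u v / u <= v}.
  move=> u v uv; apply: le_Rintegral => // t _.
  by rewrite lerD2r; apply: ndf; exact: tau_nd.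
have G0 u : 0 <= G u by exact: Rintegral_ge0.
have G1 u : G u <= f 1 - f 0.
  apply: (@le_trans _ _ (\int[unif R]_t (f 1 - f 0))).
    apply: le_Rintegral => //.
    exact: (integrable_cst_probability (unif R) (f 1 - f 0) measurableT).
  have uT : fine ((unif R : probability _ R) setT) = 1 by rewrite probability_setT.
  by rewrite Rintegral_cst// [X in _ * X]uT mulr1.
have mG : measurable_fun setT G by exact: nondecreasing_measurable.
have mGU : measurable_fun setT (G \o U) by exact: measurableT_comp.
have mUV : measurable_fun setT (fun w => (U w, V w)) by exact: measurable_fun_pair.
have mkUV : measurable_fun setT (fun w => k (U w, V w)).
  by apply: (measurableT_comp mk).
have iGU : Q.-integrable setT (EFin \o (G \o U)).
  apply: (le_integrable measurableT _ _
    (integrable_cst_probability Q (f 1 - f 0) measurableT)).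
    exact/measurable_EFinP.
  move=> t _; rewrite /= lee_fin !ger0_norm//.
  exact: le_trans (G0 0) (G1 0).
have ikUV : Q.-integrable setT (EFin \o (fun w => k (U w, V w))).
  apply: (le_integrable measurableT _ _
    (integrable_cst_probability Q (f 1 - f 0) measurableT)).
    exact/measurable_EFinP.
  move=> t _; rewrite /= lee_fin !ger0_norm//.
  exact: le_trans (G0 0) (G1 0).
exists (fun u => G u + f 0); split.
  by move=> u v uv; rewrite lerD2r ndG.
split.
- exact: measurable_funD.
- have := integrableD measurableT iGU (integrable_cst_probability Q (f 0) measurableT).
  by apply: eq_integrable => // w _; rewrite /= EFinD.
move=> B mB; have mUB := measurable_preimageT mU mB.
under eq_integral do rewrite EFinD.
under [RHS]eq_integral do rewrite /= -(subrK (f 0) (f (tau _))) EFinD.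
rewrite integralD_EFin//; last 2 first.
- exact: (integrableS measurableT).
- exact: integrable_cst_probability.
rewrite integralD_EFin//; last 2 first.
- exact: (integrableS measurableT).
- exact: integrable_cst_probability.
congr (_ + _)%E.
rewrite integral_mkcond [RHS]integral_mkcond.
pose kB (x : R * measurableTypeR R) := (\1_B x.1 * k x)%:E.
have mkB : measurable_fun setT kB.
  apply/measurable_EFinP; apply: measurable_funM => //.
  by apply: measurableT_comp => //; exact: measurable_fst.
have kB0 x : (0 <= kB x)%E by rewrite lee_fin mulr_ge0.
transitivity (\int[Q]_w kB (U w, V w))%E; last first.
  apply: eq_integral => w _; rewrite patchE /kB indicE/=.
  have -> : (w \in U @^-1` B) = (U w \in B) by apply/idP/idP; rewrite !inE.
  by case: ifP => _; rewrite (mul1r, mul0r).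
rewrite integral_independent_uniform//; apply: eq_integral => w _.
rewrite patchE.
have kBE t : kB (U w, t) = ((U w \in B)%:R * k (U w, t))%:E by rewrite /kB indicE.
under [RHS]eq_integral do rewrite kBE.
have -> : (w \in U @^-1` B) = (U w \in B) by apply/idP/idP; rewrite !inE.
case: ifP => _; last by rewrite integral0_eq// => t _; rewrite mul0r.
under eq_integral do rewrite mul1r.
apply/esym; rewrite -[LHS]fineK//.
exact: (integrable_fin_num measurableT (iku (U w))).
Qed.

End stochastic_monotonicity.

Section increasing_copula.
Context (R : realType) (d : measure_display) (Om : measurableType d)
  (P : probability Om R) (Y : {RV P >-> R})
  (d' : measure_display) (Om' : measurableType d') (Q : probability Om' R)
  (U V : {RV Q >-> R}) (F : R -> cumulativeBounded (0 : R) (1 : R)).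
Hypotheses (cY : continuous (Fdist Y)) (uU : uniform01 Q U) (uV : uniform01 Q V)
  (iUV : independent Q U V) (UV01 : forall w, 0 < U w < 1 /\ 0 < V w < 1)
  (ndF : forall y u v, 0 < u -> u <= v -> v < 1 -> F v y <= F u y)
  (meanF : forall y, \int[Q]_w F (U w) y = Fdist Y y).

Local Notation FY := (Fdist Y).

Let mU : measurable_fun setT U. Proof. exact: measurable_funPT. Qed.
Let mV : measurable_fun setT V. Proof. exact: measurable_funPT. Qed.

(* [F u y], with the meaningless values for [u] outside of the open unit
   interval replaced by 0. *)
Let F0 (y u : R) : R := if 0 < u < 1 then F u y else 0.

Let F0U y w : F (U w) y = F0 y (U w).
Proof. by rewrite /F0; have [-> _] := UV01 w. Qed.

Let F0_range y u : 0 <= F0 y u <= 1.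
Proof.
by rewrite /F0; case: ifP => _; [exact: cumulative01_range|rewrite lexx ler01].
Qed.

(** Monotonicity in [u] makes the sublevel sets inside (0,1) intervals. *)
Let measurable_F0 y : measurable_fun setT (F0 y).
Proof.
apply: measurable_fun_Iic => c.
rewrite (_ : mkset _ = [set u | 0 < u < 1 /\ F u y <= c] `|`
    (~` `]0, 1[%classic `&` [set u | 0 <= c])); last first.
  apply/seteqP; split => u /=; rewrite in_itv /F0/=.
    by case: ifPn => u01 h; [left|right].
  by case: ifPn => u01; case=> -[].
apply: measurableU.
  apply: is_interval_measurable => a b /= [/andP[a0 a1] Fa] [/andP[b0 b1] Fb].
  move=> x /andP[ax xb]; rewrite (lt_le_trans a0)// (le_lt_trans xb)//; split => //.
  by apply: le_trans Fa; apply: ndF => //; exact: le_lt_trans b1.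
apply: measurableI; first by apply: measurableC.
by apply: measurable_le_fun.
Qed.

Lemma measurable_FU y : measurable_fun setT (fun w => F (U w) y).
Proof.
rewrite (_ : (fun w => _) = F0 y \o U); last by apply/funext => w /=; exact: F0U.
exact: measurableT_comp.
Qed.

Let FU_range y w : 0 <= F (U w) y <= 1. Proof. exact: cumulative01_range. Qed.

Let integrable_FU y : Q.-integrable setT (EFin \o (fun w => F (U w) y)).
Proof.
apply: (le_integrable measurableT _ _ (integrable_cst_probability Q 1 measurableT)).
  by apply/measurable_EFinP; exact: measurable_FU.
move=> w _; rewrite /= lee_fin normr1; have /andP[F00 F01] := FU_range y w.
by rewrite ger0_norm.
Qed.

Let qUV (w : Om') : R := ginv (F (U w)) (V w).

Let sq (x : R * R) : R :=
  if (0 < x.1 < 1) && (0 < x.2 < 1) then ginv (F x.1) x.2 else 0.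

(** On the open square the Galois connection turns the sublevel set at [c] into [x.2 <= F0 c x.1],
    where [c] is fixed. *)
Let measurable_sq : measurable_fun setT sq.
Proof.
have m01 : measurable [set x : R * R | (0 < x.1 < 1) && (0 < x.2 < 1)].
  rewrite (_ : mkset _ = `]0, 1[%classic `*` `]0, 1[%classic).
    exact: measurableX.
  by apply/seteqP; split => -[x1 x2]; rewrite /= !in_itv/=; [move/andP|move=> /andP].
apply: measurable_fun_Iic => c.
rewrite (_ : mkset _ =
   ([set x : R * R | (0 < x.1 < 1) && (0 < x.2 < 1)] `&`
     [set x : R * R | x.2 <= F0 c x.1]) `|`
   (~` [set x : R * R | (0 < x.1 < 1) && (0 < x.2 < 1)] `&`
     [set x : R * R | 0 <= c])); last first.
  apply/seteqP; split => -[u t]; rewrite /sq/= /F0.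
    have [u0|] := boolP (0 < u < 1); last by move=> _ h; right.
    have [t0|] := boolP (0 < t < 1); last by move=> _ h; right.
    by rewrite /= ginv_cumulative_le//; left.
  have [u0|] := boolP (0 < u < 1); last by move=> _ [[]|[]].
  have [t0|] := boolP (0 < t < 1); last by move=> _ [[]|[]].
  by rewrite /= ginv_cumulative_le// => -[[]|[]].
apply: measurableU; apply: measurableI => //.
- apply: measurable_le_fun; first exact: measurable_snd.
  exact: (measurableT_comp (measurable_F0 c) measurable_fst).
- exact: measurableC.
- exact: measurable_le_fun.
Qed.

Let qUVE w : qUV w = sq (U w, V w).
Proof. by rewrite /sq/=; have [-> ->] := UV01 w. Qed.

Let measurable_qUV : measurable_fun setT qUV.
Proof.
rewrite (_ : qUV = sq \o (fun w => (U w, V w))); last by apply/funext => w; exact: qUVE.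
by apply: measurableT_comp => //; exact: measurable_fun_pair.
Qed.

Lemma prob_qUV (y : R) (B : set R) : measurable B ->
  (Q (U @^-1` B `&` [set w | qUV w <= y]%R) =
   \int[Q]_(w in U @^-1` B) (F (U w) y)%:E)%E.
Proof.
move=> mB.
rewrite (eq_integral (fun w => (F0 y (U w))%:E)); last by move=> w _; rewrite F0U.
rewrite -(probability_uniform_le mU uV iUV (measurable_F0 y) mB)//.
congr (Q (_ `&` _)); apply/funext => w; rewrite /mkset.
by have [_ V01] := UV01 w; rewrite /qUV ginv_cumulative_le// F0U.
Qed.

Let prob_qUV_Fdist (y : R) : Q [set w | qUV w <= y] = (FY y)%:E.
Proof.
have := prob_qUV y measurableT; rewrite preimage_setT setTI => ->.
rewrite -meanF /Rintegral fineK//.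
exact: (integrable_fin_num measurableT (integrable_FU y)).
Qed.

Let T (w : Om') : R := FY (qUV w).

Let measurable_T : measurable_fun setT T.
Proof.
apply: (measurableT_comp (f := FY)) => //.
by apply: nondecreasing_measurable => //; exact: Fdist_nd.
Qed.

Lemma uniform01_T : uniform01 Q T.
Proof.
have mT t : measurable [set w | T w <= t] by exact: measurable_le_fun.
have mq t : measurable [set w | qUV w <= t] by exact: measurable_le_fun.
apply: uniform01_cdf => // t /[dup] t01 /andP[t0 t1].
apply/eqP; rewrite eq_le; apply/andP; split.
  have fQ : Q [set w | T w <= t] \is a fin_num by exact: fin_num_measure.
  (* The distribution function may be flat at level [t], so [T w <= t] bounds [qUV w] only by the
     quantiles of the levels [s > t]. *)
  rewrite -(fineK fQ) lee_fin; apply: (le_of_lt_between t1) => s ts s1.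
  have s01 : 0 < s < 1 by rewrite (lt_trans t0).
  rewrite -lee_fin fineK// -(Fdist_ginv cY s01) -prob_qUV_Fdist.
  apply: le_measure; rewrite ?inE// => w /= Tt.
  rewrite leNgt; apply/negP => /ltW /(@Fdist_nd _ _ _ _ Y).
  by rewrite Fdist_ginv// => /le_trans /(_ Tt); rewrite leNgt ts.
rewrite -[leLHS]/((t)%:E) -{1}(Fdist_ginv cY t01) -prob_qUV_Fdist.
apply: le_measure; rewrite ?inE// => w /= qt.
by rewrite -(Fdist_ginv cY t01); exact: Fdist_nd.
Qed.

(** The event [qUV <= y] is contained in [T <= FY y], and both have probability [FY y]; flat pieces
    of [FY] therefore contribute only a null set. *)
Lemma prob_T_le (y s : R) :
  (Q [set w | (T w <= FY y)%R /\ (U w <= s)%R] =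
   \int[Q]_(w in [set w | (U w <= s)%R]) (F (U w) y)%:E)%E.
Proof.
have mT t : measurable [set w | T w <= t] by exact: measurable_le_fun.
have mq t : measurable [set w | qUV w <= t] by exact: measurable_le_fun.
have mUs t : measurable [set w | U w <= t] by exact: measurable_le_fun.
have := prob_qUV y (measurable_itv `]-oo, s]); rewrite preimage_Iic => <-.
rewrite [LHS](_ : _ = Q ([set w | U w <= s] `&` [set w | T w <= FY y])); last first.
  by congr (Q _); apply/seteqP; split => w /= [].
apply: eq_prob_ae; [exact: measurableI|exact: measurableI|].
exists ([set w | T w <= FY y] `\` [set w | qUV w <= y]); split.
- exact: measurableD.
- rewrite measureD//; last by rewrite ltey_eq fin_num_measure.
  rewrite setIidr; last by move=> w /=; exact: Fdist_nd.
  rewrite -(subee (x := (FY y)%:E))//; congr (_ - _)%E; last exact: prob_qUV_Fdist.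
  by apply: (uniform01_Iic uniform01_T); exact: Fdist_range.
- move=> w /= nw; apply: contrapT => nw'; apply: nw.
  have qT : qUV w <= y -> T w <= FY y by exact: Fdist_nd.
  have [h1|h1] := pselect (T w <= FY y); have [h2|h2] := pselect (qUV w <= y); tauto.
Qed.

Let C (y s : R) : R := \int[Q]_(w in [set w | U w <= s]) F (U w) y.

Let QU s : 0 <= s <= 1 -> fine (Q [set w | U w <= s]) = s.
Proof. by move=> s01; rewrite uniform01_Iic. Qed.

Let mUs s : measurable [set w | U w <= s].
Proof. exact: measurable_le_fun. Qed.

Lemma copula_le_hinge y s c : 0 <= s <= 1 ->
  C y s <= c * s + hinge Q (fun w => F (U w) y) c.
Proof.
move=> s01; rewrite -lerBlDl -{2}(QU s01); apply: hinge_ge => //.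
Qed.

(** At the kink [c = F s y], since [F u y] decreases in [u], the event [U <= s] lies between
    [c < F U y] and [c <= F U y], hence is optimal. *)
Lemma copula_eq_hinge y s : 0 < s < 1 ->
  C y s = F s y * s + hinge Q (fun w => F (U w) y) (F s y).
Proof.
move=> /andP[s0 s1]; have s01 : 0 <= s <= 1 by rewrite !ltW.
suff -> : hinge Q (fun w => F (U w) y) (F s y) =
    C y s - F s y * fine (Q [set w | U w <= s]) by rewrite QU// addrC subrK.
apply/hinge_eqP => //; apply: aeW => w; have [/andP[U0 U1] _] := UV01 w.
split => /= [Us|/negP]; first exact: ndF.
by rewrite -ltNge => sU; apply: ndF => //; exact: ltW.
Qed.

(* The maximum over [s] of [C y s - c * s] is attained at the end point of the
   initial segment on which [F u y] exceeds [c]. *)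
Lemma hinge_eq_copula y c : exists2 s, 0 <= s <= 1 &
  C y s = c * s + hinge Q (fun w => F (U w) y) c.
Proof.
(* The point 0 keeps [S] nonempty when [F u y] never exceeds [c]. *)
pose S := [set u : R | u = 0 \/ (0 < u < 1 /\ c < F u y)].
have S0 : S 0 by left.
have ubS : ubound S 1 by move=> u [->|[/andP[_ /ltW]]].
have supS : has_sup S by split; [exists 0|exists 1].
have s01 : 0 <= sup S <= 1.
  by rewrite (ub_le_sup (proj2 supS) S0) ge_sup//; exists 0.
exists (sup S) => //.
suff -> : hinge Q (fun w => F (U w) y) c =
    C y (sup S) - c * fine (Q [set w | U w <= sup S]) by rewrite QU// addrC subrK.
apply/hinge_eqP => //.
(* At [sup S] itself [F u y] may lie on either side of [c]; the uniform [U] charges no point. *)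
exists [set w | U w = sup S]; split.
- by apply: (measurable_preimageT mU (measurable_set1 (sup S))).
- exact: uniform01_set1.
- move=> w /= nw; apply: contrapT => /eqP Us; apply: nw.
  have [/andP[U0 U1] _] := UV01 w; split => [Ules|/negP].
    have : U w < sup S by rewrite lt_neqAle Us.
    move=> /(sup_gt (proj1 supS))[u [->|[/andP[u0 u1] cu]] Uu].
      by have := lt_trans U0 Uu; rewrite ltxx.
    by rewrite (le_trans (ltW cu))// ndF// ltW.
  rewrite -ltNge => sU; rewrite leNgt; apply/negP => cU.
  have : S (U w) by right; rewrite U0 U1.
  by move=> /(ub_le_sup (proj2 supS)); rewrite leNgt sU.
Qed.

(** Extends the rearranged transform to the plane so that it is nondecreasing in the first variable
    everywhere: the smallest value 0 to the left of (0,1), the largest value 1 to the right. *)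
Let tau (x : R * R) : R :=
  if x.1 <= 0 then 0 else if 1 <= x.1 then 1 else
  if 0 < x.2 < 1 then FY (sq x) else 0.

Let measurable_tau : measurable_fun setT tau.
Proof.
apply: measurable_fun_ifT => //=.
  by apply: measurable_fun_ler => //; exact: measurable_fst.
apply: measurable_fun_ifT => //=.
  by apply: measurable_fun_ler => //; exact: measurable_fst.
apply: measurable_fun_ifT => //=.
  apply: measurable_and.
    by apply: measurable_fun_ltr => //; exact: measurable_snd.
  by apply: measurable_fun_ltr => //; exact: measurable_snd.
apply: (measurableT_comp (f := FY)) => //.
by apply: nondecreasing_measurable => //; exact: Fdist_nd.
Qed.

Let tau_range x : 0 <= tau x <= 1.
Proof.
rewrite /tau; case: ifP => _; first by rewrite lexx ler01.
case: ifP => _; first by rewrite lexx ler01.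
by case: ifP => _; [exact: Fdist_range|rewrite lexx ler01].
Qed.

Let tau_nd u v t : u <= v -> tau (u, t) <= tau (v, t).
Proof.
move=> uv; have [u0|u0] := leP u 0.
  by rewrite {1}/tau/= u0; have /andP[] := tau_range (v, t).
have v0 : (v <= 0) = false by rewrite leNgt (lt_le_trans u0 uv).
have [v1|v1] := leP 1 v.
  by rewrite {2}/tau/= v1 v0; have /andP[] := tau_range (u, t).
have u0' : (u <= 0) = false by rewrite leNgt u0.
have v1' : (1 <= v) = false by rewrite leNgt v1.
have u1' : (1 <= u) = false by rewrite leNgt (le_lt_trans uv v1).
rewrite /tau/= u0' v0 v1' u1'.
case: ifPn => // t01; apply: Fdist_nd; rewrite /sq/= u0 v1 t01.
rewrite (lt_le_trans u0 uv) (le_lt_trans uv v1)/=.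
rewrite ginv_cumulative_le//.
apply: (le_trans _ (ndF (ginv (F v) t) u0 uv v1)).
by rewrite -ginv_cumulative_le.
Qed.

Let TE w : T w = tau (U w, V w).
Proof.
have [/andP[U0 U1] V01] := UV01 w.
have U0' : (U w <= 0) = false by rewrite leNgt U0.
have U1' : (1 <= U w) = false by rewrite leNgt U1.
by rewrite /T qUVE /tau/= U0' U1' V01.
Qed.

Lemma stoch_increasing_T : stoch_increasing Q T U.
Proof.
rewrite (_ : T = fun w => tau (U w, V w)); last by apply/funext => w; exact: TE.
exact: stoch_increasing_tau.
Qed.

End increasing_copula.

(** The weight on one side is the indicator of [B], on the other the constant [P B]. *)
Lemma independent_rays (R : realType) (d : measure_display) (Om : measurableType d)
    (P : probability Om R) (Y : Om -> R) (B : set Om) :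
  measurable_fun setT Y -> measurable B ->
  (forall y : R, P ([set w | (Y w <= y)%R] `&` B) =
    P [set w | (Y w <= y)%R] * P B)%E ->
  forall A, measurable A -> (P (Y @^-1` A `&` B) = P (Y @^-1` A) * P B)%E.
Proof.
move=> mY mB hy A mA.
have mYA C : measurable C -> measurable (Y @^-1` C) by exact: measurable_preimageT.
have fB : P B \is a fin_num by exact: fin_num_measure.
have e1 C : measurable C -> (\int[P]_(w in C) (\1_B w)%:E = P (C `&` B))%E.
  by move=> mC; rewrite integral_indic// setIC.
have e2 C : measurable C -> (\int[P]_(w in C) (fine (P B))%:E = P C * P B)%E.
  by move=> mC; rewrite integral_cst// fineK// muleC.
have i1 : P.-integrable setT (EFin \o (\1_B : Om -> R)) by exact: integrable_indic.
have hT : (\int[P]_w (\1_B w)%:E = \int[P]_w (fine (P B))%:E)%E.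
  by rewrite e1// e2// setTI probability_setT mul1e.
have hY (y : R) : (\int[P]_(w in [set w | Y w <= y]%R) (\1_B w)%:E =
    \int[P]_(w in [set w | Y w <= y]%R) (fine (P B))%:E)%E.
  have my : measurable [set w | Y w <= y] by exact: measurable_le_fun.
  by rewrite (e1 _ my) (e2 _ my) hy.
have := weighted_law_unique_ray i1
  (integrable_cst_probability P (fine (P B)) measurableT) mY mY hT hY mA.
by rewrite (e1 _ (mYA _ mA)) (e2 _ (mYA _ mA)).
Qed.

(** * Bivariate distribution functions with uniform marginals *)

Section uniform_pairs.
Context (R : realType).

Definition joint (W : bivector R) (t s : R) : R :=
  fine (bv_prob W [set w | bv_T W w <= t /\ bv_S W w <= s]).

(** The distribution function of the uniform law on (0,1). *)
Definition clamp01 (t : R) : R := Num.min (Num.max t 0) 1.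

Lemma clamp01_range t : 0 <= clamp01 t <= 1.
Proof. by rewrite /clamp01 le_min ge_min lexx orbT ler01 le_max lexx orbT. Qed.

Lemma clamp01_id t : 0 <= t <= 1 -> clamp01 t = t.
Proof. by move=> /andP[t0 t1]; rewrite /clamp01 max_l// min_l. Qed.

Lemma clamp01_nd : {homo clamp01 : s t / s <= t}.
Proof.
move=> s t st; rewrite /clamp01 le_min !ge_min lexx orbT andbT.
by rewrite ge_max !le_max st lexx orbT.
Qed.

Lemma measurable_clamp01 : measurable_fun setT clamp01.
Proof. by apply: nondecreasing_measurable => //; exact: clamp01_nd. Qed.

Section one_variable.
Context (d : measure_display) (Om : measurableType d) (Q : probability Om R)
  (U : Om -> R).
Hypothesis uU : uniform01 Q U.

Lemma uniform01_clamp s : Q [set w | U w <= s] = (clamp01 s)%:E.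
Proof.
have [mU _] := uU.
have mUs t : measurable [set w | U w <= t] by exact: measurable_le_fun.
have mono (x z : R) : x <= z -> (Q [set w | (U w <= x)%R] <= Q [set w | (U w <= z)%R])%E.
  by move=> xz; apply: le_measure; rewrite ?inE// => w /= /le_trans; apply.
have [s0|s0] := leP s 0.
  rewrite /clamp01 max_r// min_l// ?ler01//.
  apply/eqP; rewrite eq_le measure_ge0 andbT.
  by have := mono _ _ s0; rewrite (uniform01_Iic (s := 0) uU)// lexx ler01.
have [s1|s1] := leP 1 s; last first.
  by rewrite (uniform01_Iic uU) ?clamp01_id// !ltW.
rewrite /clamp01 min_r ?le_max ?s1//; apply/eqP; rewrite eq_le probability_le1//=.
by have := mono _ _ s1; rewrite (uniform01_Iic (s := 1) uU)// lexx ler01.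
Qed.

End one_variable.

Lemma Rup_joint_measurable (W : bivector R) t s : Rup W ->
  [/\ measurable [set w | bv_T W w <= t], measurable [set w | bv_S W w <= s] &
      measurable [set w | bv_T W w <= t /\ bv_S W w <= s]].
Proof.
move=> [[mT _] [mS _] _].
have h1 : measurable [set w | bv_T W w <= t] by exact: measurable_le_fun.
have h2 : measurable [set w | bv_S W w <= s] by exact: measurable_le_fun.
by split => //; exact: measurableI.
Qed.

Lemma jointE (W : bivector R) t s : Rup W ->
  bv_prob W [set w | bv_T W w <= t /\ bv_S W w <= s] = (joint W t s)%:E.
Proof.
move=> rW; have [_ _ h] := Rup_joint_measurable t s rW.
by rewrite /joint fineK// fin_num_measure.
Qed.

(** Inclusion and exclusion: with fixed marginals the survival function is an increasing function of
    [joint], so both halves of the concordance order amount to a comparison of [joint]. *)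
Lemma survivalE (W : bivector R) t s : Rup W ->
  bv_prob W [set w | bv_T W w > t /\ bv_S W w > s] =
  (1 - (clamp01 t + clamp01 s - joint W t s))%:E.
Proof.
move=> rW; have [uT uS _] := rW; have [h1 h2 h3] := Rup_joint_measurable t s rW.
rewrite (_ : mkset _ = ~` ([set w | bv_T W w <= t] `|` [set w | bv_S W w <= s])).
  rewrite probability_setC; last exact: measurableU.
  rewrite [X in (_ - X)%E]measureUfinl//; last first.
    by rewrite ltey_eq [X in X \is a fin_num](uniform01_clamp uT).
  rewrite !EFinB EFinD -jointE// -(uniform01_clamp uT) -(uniform01_clamp uS).
  by congr (_ - (_ - bv_prob W _))%E.
apply/seteqP; split => w /=.
  by move=> [tT sS] []; [rewrite leNgt tT|rewrite leNgt sS].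
by move=> /not_orP[/negP + /negP]; rewrite -!ltNge.
Qed.

(** The Frechet-Hoeffding bounds. They coincide as soon as one argument is outside (0,1), so only
    the open unit square has to be examined later. *)
Lemma joint_range (W : bivector R) t s : Rup W ->
  [/\ 0 <= joint W t s, joint W t s <= clamp01 t, joint W t s <= clamp01 s &
      clamp01 t + clamp01 s - 1 <= joint W t s].
Proof.
move=> rW; have [uT uS _] := rW; have [h1 h2 h3] := Rup_joint_measurable t s rW.
split.
- by rewrite -lee_fin -jointE.
- rewrite -lee_fin -jointE// -(uniform01_clamp uT).
  by apply: le_measure; rewrite ?inE// => w /= [].
- rewrite -lee_fin -jointE// -(uniform01_clamp uS).
  by apply: le_measure; rewrite ?inE// => w /= [].
- have : (0 <= bv_prob W [set w | (bv_T W w > t)%R /\ (bv_S W w > s)%R])%E by [].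
  by rewrite survivalE// lee_fin; lra.
Qed.

Lemma clamp01_cases t : [\/ clamp01 t = 0, clamp01 t = 1 | 0 < t < 1].
Proof.
have [t0|t0] := leP t 0.
  by apply: Or31; rewrite /clamp01 max_r// min_l// ler01.
have [t1|t1] := leP 1 t; last exact: Or33.
by apply: Or32; rewrite /clamp01 min_r// le_max t1.
Qed.

Lemma joint_le (W W' : bivector R) : Rup W -> Rup W' ->
  (forall t s, 0 < t < 1 -> 0 < s < 1 -> joint W t s <= joint W' t s) ->
  forall t s, joint W t s <= joint W' t s.
Proof.
move=> rW rW' h t s.
have [a1 a2 a3 a4] := joint_range t s rW; have [b1 b2 b3 b4] := joint_range t s rW'.
have := clamp01_cases t; have := clamp01_cases s.
by case=> e1; case=> e2; try lra; exact: h.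
Qed.

Lemma concordance_leP (W W' : bivector R) : Rup W -> Rup W' ->
  (forall t s, 0 < t < 1 -> 0 < s < 1 -> joint W t s <= joint W' t s) ->
  concordance_le W W'.
Proof.
move=> rW rW' /(joint_le rW rW') h s t; split.
  by rewrite !jointE// lee_fin.
by rewrite !survivalE// lee_fin; have := h t s; lra.
Qed.

Lemma joint_eq_law (W W' : bivector R) : bv_eq_law W W' ->
  forall t s, joint W t s = joint W' t s.
Proof.
move=> eWW t s; rewrite /joint; congr fine.
have := eWW (`]-oo, t]%classic `*` `]-oo, s]%classic).
rewrite (_ : [set w | _] = [set w | bv_T W w <= t /\ bv_S W w <= s]); last first.
  by apply/seteqP; split => w /=; rewrite !in_itv.
rewrite (_ : [set w | _ (bv_T W' w, bv_S W' w)] =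
    [set w | bv_T W' w <= t /\ bv_S W' w <= s]); last first.
  by apply/seteqP; split => w /=; rewrite !in_itv.
by apply; exact: measurableX.
Qed.

Lemma joint_product (W : bivector R) : Rup W ->
  (forall t s, 0 < t < 1 -> 0 < s < 1 -> joint W t s = t * s) ->
  forall t s, joint W t s = clamp01 t * clamp01 s.
Proof.
move=> rW h t s; have [a1 a2 a3 a4] := joint_range t s rW.
have /andP[s0 s1] := clamp01_range s; have /andP[t0 t1] := clamp01_range t.
have [es|es|s01] := clamp01_cases s; have [et|et|t01] := clamp01_cases t;
  rewrite ?es ?et ?mulr0 ?mul0r ?mulr1 ?mul1r; try lra.
have := h _ _ t01 s01; move: s01 t01 => /andP[? ?] /andP[? ?].
by rewrite !clamp01_id ?ltW.
Qed.

Lemma joint_min (W : bivector R) : Rup W ->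
  (forall t s, 0 < t < 1 -> 0 < s < 1 -> joint W t s = Num.min t s) ->
  forall t s, joint W t s = Num.min (clamp01 t) (clamp01 s).
Proof.
move=> rW h t s; have [a1 a2 a3 a4] := joint_range t s rW.
have /andP[s0 s1] := clamp01_range s; have /andP[t0 t1] := clamp01_range t.
have [es|es|s01] := clamp01_cases s; have [et|et|t01] := clamp01_cases t;
  rewrite ?es ?et; try by rewrite minElt; case: ifP => hlt; lra.
have := h _ _ t01 s01; move: s01 t01 => /andP[? ?] /andP[? ?].
by rewrite !clamp01_id ?ltW.
Qed.

Lemma joint_independentP (W : bivector R) : Rup W ->
  bv_independent W <->
  (forall t s, 0 < t < 1 -> 0 < s < 1 -> joint W t s = t * s).
Proof.
move=> rW; have [uT uS _] := rW; have [mT _] := uT; have [mS _] := uS.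
split => [iW t s /andP[t0 t1] /andP[s0 s1]|h].
  have := iW _ _ (measurable_itv `]-oo, t]) (measurable_itv `]-oo, s]).
  rewrite !preimage_Iic (uniform01_clamp uT) (uniform01_clamp uS) !clamp01_id ?ltW//.
  by move=> h; apply: EFin_inj; rewrite -jointE.
have {}h := joint_product rW h.
have mTt t : measurable [set w | bv_T W w <= t] by exact: measurable_le_fun.
have mSs s : measurable [set w | bv_S W w <= s] by exact: measurable_le_fun.
move=> A B mA mB; rewrite setIC muleC; apply: (independent_rays mS) => //.
  exact: measurable_preimageT mA.
move=> s; rewrite setIC muleC; apply: (independent_rays mT) => // t.
rewrite (uniform01_clamp uT) (uniform01_clamp uS) -EFinM -h -jointE//.
Qed.

(** On the diagonal, [T <= r] and [S <= r] are events of the same probability as their intersection,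
    hence equal a.s.; if [T] and [S] differed, a rational [r] would separate them. *)
Lemma joint_comonotoneP (W : bivector R) : Rup W ->
  bv_comonotone W <->
  (forall t s, 0 < t < 1 -> 0 < s < 1 -> joint W t s = Num.min t s).
Proof.
move=> rW; have [uT uS _] := rW; have [mT _] := uT; have [mS _] := uS.
split => [cW t s /andP[t0 t1] /andP[s0 s1]|h].
  have [h1 h2 h3] := Rup_joint_measurable t s rW.
  apply: EFin_inj; rewrite -jointE//.
  have m01 : 0 <= Num.min t s <= 1.
    by rewrite le_min ge_min !ltW.
  rewrite -(uniform01_Iic uS m01); apply: eq_prob_ae => //.
    exact: measurable_le_fun.
  by apply: filterS cW => w /= ->; rewrite le_min; split => [[-> ->]|/andP].
have {}h r : joint W r r = clamp01 r by rewrite (joint_min rW h) minxx.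
have k1 r : {ae bv_prob W, forall w, bv_T W w <= r -> bv_S W w <= r}.
  have [h1 h2 h3] := Rup_joint_measurable r r rW.
  exists ([set w | bv_T W w <= r] `\` [set w | bv_S W w <= r]); split.
  - exact: measurableD.
  - rewrite measureD//; last by rewrite ltey_eq fin_num_measure.
    rewrite [X in (X - _)%E](uniform01_clamp uT).
    by rewrite [X in (_ - X)%E](jointE r r rW) h subee.
  - by move=> w /= /not_implyP.
have k2 r : {ae bv_prob W, forall w, bv_S W w <= r -> bv_T W w <= r}.
  have [h1 h2 h3] := Rup_joint_measurable r r rW.
  exists ([set w | bv_S W w <= r] `\` [set w | bv_T W w <= r]); split.
  - exact: measurableD.
  - rewrite measureD//; last by rewrite ltey_eq fin_num_measure.
    rewrite [X in (X - _)%E](uniform01_clamp uS) setIC.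
    by rewrite [X in (_ - X)%E](jointE r r rW) h subee.
  - by move=> w /= /not_implyP.
have kn : {ae bv_prob W, forall w, forall n : nat,
    let r := ratr (odflt 0 (unpickle n)) : R in
    (bv_T W w <= r -> bv_S W w <= r) /\ (bv_S W w <= r -> bv_T W w <= r)}.
  apply: ae_foralln => n.
  move: (k1 (ratr (odflt 0 (unpickle n)))) (k2 (ratr (odflt 0 (unpickle n)))).
  by apply: filterS2.
apply: filterS kn => w hw.
apply/eqP; rewrite eq_le; apply/andP; split; rewrite leNgt; apply/negP;
  move=> /rat_in_itvoo[r]; rewrite in_itv/= => /andP[r1 r2];
  have := hw (pickle r); rewrite pickleK/= => -[r3 r4].
  by have := r4 (ltW r1); rewrite leNgt r2.
by have := r3 (ltW r1); rewrite leNgt r2.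
Qed.

End uniform_pairs.

(** * Rearranged quantile transforms *)

Section comparison_pairs.
Context (R : realType) (d : measure_display) (Om : measurableType d)
  (Q : probability Om R) (U V : {RV Q >-> R}).
Hypotheses (uU : uniform01 Q U) (uV : uniform01 Q V) (iUV : independent Q U V)
  (UV01 : forall w, 0 < U w < 1 /\ 0 < V w < 1).

Let clampE w : clamp01 (U w) = U w /\ clamp01 (V w) = V w.
Proof.
by have [/andP[? ?] /andP[? ?]] := UV01 w; rewrite !clamp01_id// !ltW.
Qed.

(** This pair and the comonotone one are the members of [Rup] at which [mu] is 0 and 1, against
    which its other values are bounded. [clamp01] keeps [tau] in [0,1] away from the values of [U]
    and [V]. *)
Lemma Rup_independent_pair :
  Rup (Bivector Q V U) /\ bv_independent (Bivector Q V U).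
Proof.
have [mU _] := uU.
split; last by move=> A B mA mB; rewrite /= setIC muleC; exact: iUV.
split => //=.
have := @stoch_increasing_tau _ _ _ Q U V (fun x => clamp01 x.2) mU uV iUV.
rewrite (_ : (fun w => clamp01 _) = V); last by apply/funext => w /=; have [] := clampE w.
apply.
- by apply: measurableT_comp; [exact: measurable_clamp01|exact: measurable_snd].
- by move=> x; exact: clamp01_range.
- by move=> u v t _ /=.
Qed.

Lemma Rup_comonotone_pair :
  Rup (Bivector Q U U) /\ bv_comonotone (Bivector Q U U).
Proof.
have [mU _] := uU.
split; last by apply: aeW => w.
split => //=.
have := @stoch_increasing_tau _ _ _ Q U V (fun x => clamp01 x.1) mU uV iUV.
rewrite (_ : (fun w => clamp01 _) = U); last by apply/funext => w /=; have [] := clampE w.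
apply.
- by apply: measurableT_comp; [exact: measurable_clamp01|exact: measurable_fst].
- by move=> x; exact: clamp01_range.
- by move=> u v t uv /=; exact: clamp01_nd.
Qed.

End comparison_pairs.

Section rearrangement_law.
Context (R : realType) (d : measure_display) (Om : measurableType d)
  (P : probability Om R) (p : nat) (X : {RV P >-> p.-tuple R})
  (qX : p.-tuple R -> p.-tuple R) (h : p.-tuple R -> R) (hs : R -> R)
  (d' : measure_display) (Om' : measurableType d') (Q : probability Om' R)
  (U : {RV Q >-> R}).
Hypotheses (mqtX : is_mqt X qX) (mh : measurable_fun setT h)
  (rh : is_dec_rearrangement (fun u => h (qX u)) hs)
  (uU : uniform01 Q U) (U01 : forall w, 0 < U w < 1)
  (mhs : measurable_fun setT (fun w => hs (U w))).

(** The rearrangement matches superlevel sets of [hs] with those of [h] composed with [qX] on the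
    cube, and [mqt_law] moves the latter to [X]. *)
Lemma rearrangement_law (A : set R) : measurable A ->
  Q ((fun w => hs (U w)) @^-1` A) = P ((fun w => h (X w)) @^-1` A).
Proof.
move=> mA; have [ndhs lawhs] := rh.
have mX : measurable_fun setT X by exact: measurable_funPT.
have mhX : measurable_fun setT (fun w => h (X w)) by exact: measurableT_comp.
have ge_law c : Q [set w | c <= hs (U w)] = P [set w | c <= h (X w)].
  have mB : measurable [set u : R | 0 < u < 1 /\ c <= hs u].
    apply: is_interval_measurable => a b /= [/andP[a0 a1] ca] [/andP[b0 b1] cb].
    move=> x /andP[ax xb]; rewrite (lt_le_trans a0)// (le_lt_trans xb)//; split => //.
    by apply: (le_trans cb); apply: ndhs => //; exact: lt_le_trans ax.
  have mS : measurable [set x | c <= h x] by exact: measurable_le_fun.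
  transitivity (Q (U @^-1` [set u | 0 < u < 1 /\ c <= hs u])).
    by congr (Q _); apply/seteqP; split => w /=; [split|case].
  have [_ ->//] := uU; rewrite uniform_probE// setIidl; last first.
    by move=> u /= [/andP[u0 u1] _]; rewrite in_itv/= !ltW.
  rewrite lawhs -(mqt_law mqtX mS); apply/esym.
  rewrite (_ : @open_cube R p `&` _ =
      @open_cube R p `&` cube_extension qX @^-1` [set x | c <= h x]); last first.
    by apply/seteqP; split => u [ou] /=; rewrite /cube_extension asboolT.
  have mqS : measurable (cube_extension qX @^-1` [set x | c <= h x]).
    by apply: measurable_preimageT mS; exact: measurable_cube_extension mqtX.
  apply: eq_prob_ae => //.
    by apply: measurableI => //; exact: measurable_open_cube.
  by apply: filterS (cube_open_cube R p) => u ou; split => // -[].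
(* Superlevel sets are known, while uniqueness is stated for the rays [<= y]; negation exchanges
   them. *)
have mNhs : measurable_fun setT (fun w => - hs (U w)) by exact: measurable_funN.
have mNhX : measurable_fun setT (fun w => - h (X w)) by exact: measurable_funN.
have hy (y : R) : Q [set w | - hs (U w) <= y] = P [set w | - h (X w) <= y].
  have := ge_law (- y); congr (_ = _).
    by congr (Q _); apply/funext => w; rewrite /mkset lerNl.
  by congr (P _); apply/funext => w; rewrite /mkset lerNl.
have mNA : measurable (-%R @^-1` A).
  by apply: measurable_preimageT mA; exact: measurable_funN.
have := law_unique_ray mNhs mNhX hy mNA.
have e T (k : T -> R) : (fun w => - k w) @^-1` (-%R @^-1` A) = k @^-1` A.
  by apply/funext => w; rewrite /preimage/mkset opprK.
by rewrite !e.
Qed.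

End rearrangement_law.

Section representation.
Context (R : realType) (mu : bivector R -> R) (d : measure_display)
  (Om : measurableType d) (P : probability Om R) (Y : {RV P >-> R}) (p : nat)
  (X : {RV P >-> p.-tuple R}).

(* The law of [W], seen through its distribution function, and the laws of the
   conditional probabilities [g y (X)] determine each other by Legendre
   duality. *)
Definition represents (g : R -> p.-tuple R -> R) (W : bivector R) : Prop :=
  forall y, [/\
    forall s c, 0 <= s <= 1 ->
      joint W (Fdist Y y) s <= c * s + hinge P (g y \o X) c,
    forall s, 0 < s < 1 -> exists2 c, 0 <= c <= 1 &
      joint W (Fdist Y y) s = c * s + hinge P (g y \o X) c &
    forall c, exists2 s, 0 <= s <= 1 &
      joint W (Fdist Y y) s = c * s + hinge P (g y \o X) c].

Lemma is_Rmu_represented (r : R) : continuous (Fdist Y) -> is_Rmu mu Y X r ->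
  exists (W W0 W1 : bivector R) (g : R -> p.-tuple R -> R),
    [/\ r = mu W /\ Rup W, Rup W0 /\ bv_independent W0,
        Rup W1 /\ bv_comonotone W1,
        forall y, is_cond_prob P [set w | Y w <= y] X (g y) &
        represents g W].
Proof.
move=> cY [q [d' [Om' [Q [U [V [rq [uU uV] iUV UV01 rE]]]]]]].
have [qX [g [F [mqtX cg rear qE]]]] := rq.
have [rW0 iW0] := Rup_independent_pair uU uV iUV UV01.
have [rW1 iW1] := Rup_comonotone_pair uU uV iUV UV01.
exists (Bivector Q (fun w => Fdist Y (ginv (F (U w)) (V w))) U), (Bivector Q V U),
  (Bivector Q U U), g.
have U01 w : 0 < U w < 1 by have [] := UV01 w.
have ndF y u v : 0 < u -> u <= v -> v < 1 -> F v y <= F u y.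
  by have [+ _] := rear y; apply.
have mX : measurable_fun setT X by exact: measurable_funPT.
have mY y : measurable [set w | Y w <= y].
  by apply: measurable_le_fun => //; exact: measurable_funPT.
have mg y : measurable_fun setT (g y) by case: (cg y).
have mgX y : measurable_fun setT (g y \o X) by exact: measurableT_comp.
have mFU y : measurable_fun setT (fun w => F (U w) y).
  exact: (measurable_FU UV01 ndF).
have hE y c : hinge Q (fun w => F (U w) y) c = hinge P (g y \o X) c.
  apply: hinge_eq_law => // A mA.
  exact: (rearrangement_law mqtX (mg y) (rear y) uU U01 (mFU y)).
(* With kink 0, equality of hinges becomes equality of means: [F] is nonnegative everywhere and
   [g y (X)] a.s. *)
have meanF y : \int[Q]_w F (U w) y = Fdist Y y.
  have <- : fine (P [set w | Y w <= y]) = Fdist Y y by rewrite FdistE.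
  rewrite -(cond_prob_expectation mX (mY y) (cg y)).
  have := hE y 0; rewrite /hinge.
  under eq_Rintegral => w _ do rewrite subr0 max_l ?(andP (cumulative01_range _ _)).1//.
  move=> ->; apply: eq_Rintegral_ae => //.
  - by apply: measurable_maxr => //; exact: measurable_funB.
  - exact: mgX.
  apply: filterS (cond_prob_range mX (mY y) (cg y)) => w /andP[g0 _] _ /=.
  by rewrite subr0 max_l.
have jE y s : joint (Bivector Q (fun w => Fdist Y (ginv (F (U w)) (V w))) U)
    (Fdist Y y) s = \int[Q]_(w in [set w | U w <= s]) F (U w) y.
  by rewrite /joint/= (prob_T_le cY uV iUV UV01 ndF meanF).
have eT : (fun w => Fdist Y (q (U w) (V w))) =
          (fun w => Fdist Y (ginv (F (U w)) (V w))).
  by apply/funext => w; have [? ?] := UV01 w; rewrite qE.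
split => //.
- split; first by rewrite rE eT.
  split => //=.
  + exact: (uniform01_T cY uV iUV UV01 ndF meanF).
  + exact: (stoch_increasing_T uV iUV UV01 ndF).
- move=> y; split => [s c s01|s s01|c].
  + by rewrite jE -hE; exact: (copula_le_hinge uU UV01 ndF).
  + exists (F s y); first exact: cumulative01_range.
    by rewrite jE -hE; exact: (copula_eq_hinge uU UV01 ndF).
  + have [s s01 sE] := hinge_eq_copula uU UV01 ndF y c.
    by exists s => //; rewrite jE -hE.
Qed.

End representation.

(** * Comparison of hinges and the conditional convex order *)

Lemma continuous_Fdist_set1 (R : realType) (d : measure_display)
    (Om : measurableType d) (P : probability Om R) (Y : {RV P >-> R}) (y : R) :
  continuous (Fdist Y) -> P [set w | Y w = y] = 0%E.
Proof.
move=> cY.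
have mY : measurable_fun setT Y by exact: measurable_funPT.
have mYs t : measurable [set w | Y w <= t] by exact: measurable_le_fun.
have m1 : measurable [set w | Y w = y].
  exact: (measurable_preimageT mY (measurable_set1 y)).
have fP : P [set w | Y w = y] \is a fin_num by exact: fin_num_measure.
have le z : z < y -> Fdist Y z <= Fdist Y y - fine (P [set w | Y w = y]).
  move=> zy; rewrite lerBrDr -lee_fin EFinD (fineK fP) -!FdistE -measureU//.
    apply: le_measure; rewrite ?inE//; first exact: measurableU.
    by move=> w /= [Yz|->//]; rewrite (le_trans Yz)// ltW.
  by apply/seteqP; split => // w /= [Yz Yy]; move: Yz; rewrite Yy leNgt zy.
have cl : Fdist Y z @[z --> y^'-] --> Fdist Y y.
  by apply: cvg_at_left_filter; exact: cY.
have : Fdist Y y <= Fdist Y y - fine (P [set w | Y w = y]).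
  by apply: (cvgr_to_le cl); near=> z; apply: le; near: z; exact: nbhs_left_lt.
rewrite -[leLHS]subr0 lerD2l lerN2 => h.
by rewrite -(fineK fP); congr EFin; apply/eqP; rewrite eq_le h fine_ge0.
Unshelve. all: by end_near. Qed.

(** The kink [c] attained for [W'] is inserted into the upper bound for [W]. The points [y] and [y']
    may differ, since different vectors are compared at quantiles of a common level. *)
Lemma joint_le_hinge (R : realType) d (Om : measurableType d) (P : probability Om R)
    (Y : {RV P >-> R}) (p : nat) (X : {RV P >-> p.-tuple R})
    d' (Om' : measurableType d') (P' : probability Om' R)
    (Y' : {RV P' >-> R}) (p' : nat) (X' : {RV P' >-> p'.-tuple R})
    (g : R -> p.-tuple R -> R) (g' : R -> p'.-tuple R -> R) (W W' : bivector R)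
    (y y' s : R) :
  represents Y X g W -> represents Y' X' g' W' -> Fdist Y y = Fdist Y' y' ->
  (forall c, hinge P (g y \o X) c <= hinge P' (g' y' \o X') c) ->
  0 < s < 1 -> joint W (Fdist Y y) s <= joint W' (Fdist Y y) s.
Proof.
move=> rep rep' eF hle s01; have [up _ _] := rep y; have [_ attained _] := rep' y'.
have [c _] := attained _ s01; rewrite eF => ->; rewrite -eF.
rewrite (le_trans (up s c _))// ?lerD2l//.
by case/andP: s01 => s0 s1; rewrite !ltW.
Qed.

(** The hinge is reflected because the conditional convex order speaks of [P(Y >= y | X)], which is
    1 minus the conditional probability used here. *)
Lemma convex_max0 (R : realType) (c : R) :
  @convex_function R R^o setT (fun x => Num.max (1 - x - c) 0).
Proof.
move=> t x y _ _.
have -> : conv t x y = t%:num * x + (1 - t%:num) * y :> R by exact: convRE.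
rewrite convRE.
have t0 : 0 <= t%:num by [].
have t1 : 0 <= 1 - t%:num by rewrite subr_ge0.
set a := (X in _ <= t%:num * X + _); set b := (X in _ <= _ + _ * X).
have a0 : 0 <= a by rewrite le_max lexx orbT.
have b0 : 0 <= b by rewrite le_max lexx orbT.
have ax : 1 - x - c <= a by rewrite le_max lexx.
have by_ : 1 - y - c <= b by rewrite le_max lexx.
rewrite ge_max; apply/andP; split; last by rewrite addr_ge0// mulr_ge0.
apply: le_trans (lerD (ler_wpM2l t0 ax) (ler_wpM2l t1 by_)).
by rewrite le_eqVlt; apply/orP; left; apply/eqP; ring.
Qed.

(** The complement of [y <= Y] differs from [Y <= y] by the event [Y = y], which is null by
    continuity. *)
Lemma cond_prob_ge_le (R : realType) (d : measure_display)
    (Om : measurableType d) (P : probability Om R) (Y : {RV P >-> R}) (y : R)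
    d' (E : measurableType d') (X : Om -> E) (k : E -> R) :
  continuous (Fdist Y) -> measurable_fun setT X ->
  is_cond_prob P [set w | y <= Y w] X k ->
  is_cond_prob P [set w | Y w <= y] X (fun x => 1 - k x).
Proof.
move=> cY mX ck.
have mY : measurable_fun setT Y by exact: measurable_funPT.
have m1 : measurable [set w | y <= Y w] by exact: measurable_le_fun.
have m2 : measurable [set w | Y w <= y] by exact: measurable_le_fun.
apply: (is_cond_prob_ae_event mX (measurableC m1) m2 _ _ (is_cond_prob_setC mX m1 ck)).
  rewrite (_ : _ `\` _ = set0) ?measure0//; apply/seteqP; split => // w /= [].
  by move=> /negP; rewrite -ltNge => /ltW.
rewrite (_ : _ `\` _ = [set w | Y w = y]); first exact: continuous_Fdist_set1.
apply/seteqP; split => w /=; last by move=> ->; split => //; exact.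
by move=> [Yy /contrapT yY]; apply/eqP; rewrite eq_le Yy yY.
Qed.

Lemma ccx_le_hinge (R : realType) d (Om : measurableType d) (P : probability Om R)
    (Y : {RV P >-> R}) (p : nat) (X : {RV P >-> p.-tuple R})
    d' (Om' : measurableType d') (P' : probability Om' R)
    (Y' : {RV P' >-> R}) (p' : nat) (X' : {RV P' >-> p'.-tuple R})
    (g : p.-tuple R -> R) (g' : p'.-tuple R -> R) (v c : R) :
  continuous (Fdist Y) -> continuous (Fdist Y') -> ccx_le Y X Y' X' -> 0 < v < 1 ->
  is_cond_prob P [set w | Y w <= ginv (Fdist Y) v] X g ->
  is_cond_prob P' [set w | Y' w <= ginv (Fdist Y') v] X' g' ->
  hinge P (g \o X) c <= hinge P' (g' \o X') c.
Proof.
move=> cY cY' ccx v01 cg cg'.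
have [k [k' [ck ck' kk']]] := ccx v v01.
have key d0 (T : measurableType d0) (Q : probability T R) (Y0 : {RV Q >-> R}) n
    (X0 : {RV Q >-> n.-tuple R}) (y : R) (g0 k0 : n.-tuple R -> R) :
    continuous (Fdist Y0) -> is_cond_prob Q [set w | Y0 w <= y] X0 g0 ->
    is_cond_prob Q [set w | y <= Y0 w] X0 k0 ->
    ((hinge Q (g0 \o X0) c)%:E =
     'E_Q[(fun x => Num.max (1 - x - c)%R 0%R) \o (k0 \o X0)])%E.
  move=> cY0 cg0 ck0.
  have mX0 : measurable_fun setT X0 by exact: measurable_funPT.
  have mY0 : measurable [set w | Y0 w <= y].
    by apply: measurable_le_fun => //; exact: measurable_funPT.
  have ck1 := cond_prob_ge_le cY0 mX0 ck0.
  have [mg0 _ _] := cg0; have [mk1 ik1 _] := ck1.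
  rewrite (hinge_ae c _ _ (cond_prob_unique mX0 mY0 cg0 ck1)); last 2 first.
  - exact: measurableT_comp.
  - exact: (measurableT_comp mk1 mX0).
  rewrite /hinge /Rintegral fineK ?unlock//.
  exact: integrable_fin_num (integrable_max0 c ik1).
by rewrite -lee_fin (key _ _ _ _ _ _ _ _ _ cY cg ck) (key _ _ _ _ _ _ _ _ _ cY' cg' ck');
  apply: kk'; exact: convex_max0.
Qed.

(** * Independence and functional dependence as extreme cases *)

Lemma hinge_cst (R : realType) (d : measure_display) (Om : measurableType d)
    (P : probability Om R) (v c : R) :
  hinge P (fun=> v) c = Num.max (v - c) 0.
Proof.
rewrite /hinge Rintegral_cst//.
have e : fine (P setT) = 1 by rewrite probability_setT.
by rewrite [X in _ * X]e mulr1.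
Qed.

Lemma is_cond_prob_cst (R : realType) (d d' : measure_display)
    (Om : measurableType d) (E : measurableType d') (P : probability Om R)
    (A : set Om) (X : Om -> E) (v : R) :
  measurable_fun setT X -> measurable A -> P A = v%:E ->
  is_cond_prob P A X (fun=> v) <->
  forall B, measurable B -> P (A `&` X @^-1` B) = (P A * P (X @^-1` B))%E.
Proof.
move=> mX mA PA.
have e B : measurable B -> (\int[P]_(w in X @^-1` B) v%:E = P A * P (X @^-1` B))%E.
  by move=> mB; rewrite integral_cst ?PA//; exact: measurable_preimageT mB.
split=> [/(is_cond_probP P mX mA)[_ _ h] B mB|h].
  by rewrite -h// e.
apply/(is_cond_probP P mX mA); split => //.
  exact: integrable_cst_probability.
by move=> B mB; rewrite e// h.
Qed.

(** The Legendre dual of the comonotone copula: min(v, s) - c s is maximal over [0,1] at 1, [v] or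
    0, according to whether [c] is below, in or above [0,1]. The optimal events are [setT], [A] and
    [set0]. *)
Lemma hinge_indic (R : realType) (d : measure_display) (Om : measurableType d)
    (P : probability Om R) (A : set Om) (v c : R) : measurable A ->
  P A = v%:E -> exists2 s, [\/ s = 0, s = v | s = 1] &
    hinge P (\1_A) c = Num.min v s - c * s.
Proof.
move=> mA PA.
have iA : P.-integrable setT (EFin \o (\1_A : Om -> R)) by exact: integrable_indic.
have /andP[v0 v1] : 0 <= v <= 1.
  by rewrite -!lee_fin -PA measure_ge0 probability_le1.
have eD D : measurable D -> \int[P]_(w in D) \1_A w = fine (P (A `&` D)).
  by move=> mD; rewrite /Rintegral integral_indic.
have [c0|c0] := ltP c 0.
  exists 1; [exact: Or33|]; rewrite min_l//.
  rewrite (proj2 (hinge_eqP c measurableT iA)).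
    by rewrite eD// setIT PA probability_setT.
  by apply: aeW => w; split => [_|[]//]; rewrite (le_trans (ltW c0)).
have [c1|c1] := leP c 1.
  exists v; [exact: Or32|]; rewrite minxx.
  rewrite (proj2 (hinge_eqP c mA iA)); first by rewrite eD// setIid PA.
  apply: aeW => w; split => [Aw|nAw]; rewrite indicE.
    by rewrite mem_set.
  by rewrite memNset.
exists 0; [exact: Or31|]; rewrite min_r// mulr0 subrr.
rewrite (proj2 (hinge_eqP c measurable0 iA)).
  by rewrite eD// setI0 measure0 mulr0 subrr.
by apply: aeW => w; split => [[]|_]; rewrite (le_trans _ (ltW c1)).
Qed.

Lemma is_cond_prob_indic (R : realType) (d d' : measure_display)
    (Om : measurableType d) (E : measurableType d') (P : probability Om R)
    (X : Om -> E) (C : set E) : measurable_fun setT X -> measurable C ->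
  is_cond_prob P (X @^-1` C) X (\1_C : E -> R).
Proof.
move=> mX mC; have mXC := measurable_preimageT mX mC.
have e : \1_C \o X = \1_(X @^-1` C) :> (Om -> R).
  by apply/funext => w; rewrite /= !indicE.
split; first exact: measurable_indic.
  by rewrite e; exact: integrable_indic.
by move=> B mB; apply: eq_integral => w _; rewrite -e.
Qed.

Section extreme_values.
Context (R : realType) (d : measure_display) (Om : measurableType d)
  (P : probability Om R) (Y : {RV P >-> R}) (p : nat)
  (X : {RV P >-> p.-tuple R}) (g : R -> p.-tuple R -> R) (W : bivector R).
Hypotheses (cY : continuous (Fdist Y)) (rW : Rup W)
  (cg : forall y, is_cond_prob P [set w | Y w <= y] X (g y))
  (rep : represents Y X g W).

Let mX : measurable_fun setT X. Proof. exact: measurable_funPT. Qed.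
Let mY : measurable_fun setT Y. Proof. exact: measurable_funPT. Qed.
Let mYy y : measurable [set w | Y w <= y]. Proof. exact: measurable_le_fun. Qed.
Let mgX y : measurable_fun setT (g y \o X).
Proof. by have [mg _ _] := cg y; exact: measurableT_comp. Qed.
Let igX y : P.-integrable setT (EFin \o (g y \o X)).
Proof. by have [_ ig _] := cg y. Qed.

(** The events [setT] and [set0] bound the hinge below by [v - c] and 0, where [v = Fdist Y y]; for
    [c] and [s] in [0,1], c s + max(v - c, 0) is at least v s. *)
Lemma joint_ge_product y s : 0 < s < 1 ->
  Fdist Y y * s <= joint W (Fdist Y y) s.
Proof.
move=> /[dup] s01 /andP[s0 s1]; have [_ /(_ _ s01) [c c01 ->] _] := rep y.
have h1 := hinge_ge c measurableT (igX y).
have h2 := hinge_ge c measurable0 (igX y).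
move: h1 h2; rewrite Rintegral_set0 measure0 probability_setT /=.
rewrite (cond_prob_expectation mX (mYy y) (cg y)) FdistE/= => h1 h2.
move: c01 => /andP[c0 c1]; have /andP[v0 v1] := Fdist_range Y y.
have [cv|vc] := leP c (Fdist Y y); nra.
Qed.

Lemma joint_product_independent :
  (forall t s, 0 < t < 1 -> 0 < s < 1 -> joint W t s = t * s) <->
  independent P Y X.
Proof.
split=> [/(joint_product rW) h|iYX].
  have cc y : is_cond_prob P [set w | Y w <= y] X (fun=> Fdist Y y).
    (* The constant vector carries no information, so [Fdist Y y] is the conditional probability
       given it, and the equality case of refinement applies to [X0] and [X]. *)
    pose X0 := fun _ : Om => 0 : R.
    have mX0 : measurable_fun setT X0 by exact: measurable_cst.
    have cX0 : is_cond_prob P [set w | Y w <= y] X0 (fun=> Fdist Y y).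
      apply/is_cond_prob_cst => //; first exact: FdistE.
      move=> B mB; have [B0|nB0] := pselect (B 0).
        rewrite (_ : X0 @^-1` B = setT); last by apply/seteqP; split.
        by rewrite setIT probability_setT mule1.
      rewrite (_ : X0 @^-1` B = set0); last by apply/seteqP; split.
      by rewrite setI0 measure0 mule0.
    apply: (is_cond_prob_ae mX (cg y)) => //.
    have sX B : measurable B -> exists2 B', measurable B' & X0 @^-1` B = X @^-1` B'.
      move=> mB; have [B0|nB0] := pselect (B 0).
        by exists setT => //; apply/seteqP; split.
      by exists set0 => //; apply/seteqP; split.
    apply: filterS (hinge_refinement_eq mX0 mX (mYy y) sX cX0 (cg y) _) => [w <-//|c].
    (* At the attaining [s], the product form of [joint] makes the hinge equal to
       [(Fdist Y y - c) * s], which is at most the hinge of the constant. *)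
    have [_ _ /(_ c) [s s01 sE]] := rep y.
    rewrite -[leLHS](addKr (c * s)) -sE h !clamp01_id ?Fdist_range//.
    rewrite (_ : _ \o _ = (fun=> Fdist Y y))// hinge_cst.
    move: s01 => /andP[s0 s1]; rewrite le_max.
    have [cv|vc] := leP c (Fdist Y y); apply/orP; [left|right]; nra.
  move=> A B mA mB.
  apply: (independent_rays mY) => //; first exact: measurable_preimageT mB.
  by move=> y; apply: (is_cond_prob_cst mX (mYy y) (FdistE Y y)).1.
move=> t s t01 s01; rewrite -(Fdist_ginv cY t01); set y := ginv _ t.
apply/eqP; rewrite eq_le joint_ge_product// andbT.
have cc : is_cond_prob P [set w | Y w <= y] X (fun=> Fdist Y y).
  apply/(is_cond_prob_cst mX (mYy y) (FdistE Y y)) => B mB.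
  by have := iYX _ _ (measurable_itv `]-oo, y]) mB; rewrite preimage_Iic.
(* At the kink [Fdist Y y] the hinge of the constant vanishes, so the upper bound is the product
   itself. *)
have [up _ _] := rep y; have := up s (Fdist Y y).
rewrite (hinge_ae _ (mgX y) _ (cond_prob_unique mX (mYy y) (cg y) cc))//.
rewrite hinge_cst subrr maxxx addr0; apply.
by case/andP: s01 => s0 s1; rewrite !ltW.
Qed.

(* [\1_C] is the conditional probability of [Y <= y] given [(X, Y)]. *)
Lemma joint_min_functional :
  (forall t s, 0 < t < 1 -> 0 < s < 1 -> joint W t s = Num.min t s) <->
  exists f : p.-tuple R -> R,
    measurable_fun setT f /\ {ae P, forall w, Y w = f (X w)}.
Proof.
split=> [/(joint_min rW) h|[f [mf fE]]].
  have gE y : {ae P, forall w, g y (X w) = (\1_[set w | Y w <= y] : Om -> R) w}.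
    pose X2 w := (X w, Y w : measurableTypeR R).
    pose C := [set x : p.-tuple R * measurableTypeR R | x.2 <= y].
    have mX2 : measurable_fun setT X2 by exact: measurable_fun_pair.
    have mC : measurable C by apply: measurable_le_fun => //; exact: measurable_snd.
    have cX2 : is_cond_prob P [set w | Y w <= y] X2 (\1_C) by exact: is_cond_prob_indic.
    have sX B : measurable B -> exists2 B', measurable B' & X @^-1` B = X2 @^-1` B'.
      move=> mB; exists (B `*` setT); first exact: measurableX.
      by apply/seteqP; split => w //= [].
    have e : \1_C \o X2 = \1_[set w | Y w <= y] :> (Om -> R).
      by apply/funext => w; rewrite /= !indicE.
    apply: filterS (hinge_refinement_eq mX mX2 (mYy y) sX (cg y) cX2 _) => [w ->|c].
      by rewrite -e.
    (* The hinge of the indicator is [Num.min v s - c * s] for some [s]; there [joint] equals this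
       minimum, and its upper bound gives the reverse hinge inequality. *)
    rewrite e; have [s s3 ->] := hinge_indic c (mYy y) (FdistE Y y).
    have [v0 v1] := andP (Fdist_range Y y).
    have s01 : 0 <= s <= 1 by case: s3 => ->; rewrite ?lexx ?ler01 ?v0.
    have [up _ _] := rep y; have := up s c s01.
    by rewrite h !clamp01_id ?Fdist_range// lerBlDl.
  (* Almost surely [g r (X) = 1] exactly when [Y <= r], for all rational [r] at once. Hence [Y] is
     recovered from [X] as the infimum of these [r]; the value [+oo] discards the others. *)
  pose q n : R := ratr (odflt 0 (unpickle n)).
  pose k n x : \bar R := if g (q n) x == 1 then (q n)%:E else +oo%E.
  exists (fun x => fine (einfs (k ^~ x) 0)); split.
    apply: measurableT_comp => //; apply: measurable_fun_einfs => n.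
    have [mg _ _] := cg (q n).
    by apply: measurable_fun_ifT => //; exact: measurable_fun_eqr.
  apply: filterS (ae_foralln (fun n => gE (q n))) => w hw.
  suff -> : einfs (k ^~ (X w)) 0 = (Y w)%:E by [].
  apply/eqP; rewrite eq_le; apply/andP; split.
    apply/lee_addgt0Pr => e e0.
    have /rat_in_itvoo[r] : Y w < Y w + e by rewrite ltrDl.
    rewrite in_itv/= => /andP[Yr re].
    apply: (@le_trans _ _ (ratr r)%:E); last by rewrite -EFinD lee_fin ltW.
    apply: ereal_inf_lbound; exists (pickle r) => //.
    have := hw (pickle r); rewrite /k /q pickleK/= => ->.
    by rewrite indicE mem_set ?eqxx//= ltW.
  apply: le_ereal_inf_tmp => _ [n _ <-]; rewrite /k hw indicE.
  case: ifPn; last by rewrite leey.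
  have [Yq|Yq] := pselect (Y w <= q n); first by rewrite lee_fin.
  by rewrite memNset// eq_sym oner_eq0.
move=> t s t01 s01; have /andP[t0 t1] := t01; have /andP[s0 s1] := s01.
apply/eqP; rewrite eq_le; apply/andP; split.
  have [_ j1 j2 _] := joint_range t s rW.
  have ct : clamp01 t = t by rewrite clamp01_id// !ltW.
  have cs : clamp01 s = s by rewrite clamp01_id// !ltW.
  by move: j1 j2; rewrite ct cs le_min => -> ->.
rewrite -(Fdist_ginv cY t01); set y := ginv _ t.
have cf : is_cond_prob P [set w | Y w <= y] X (\1_[set x | f x <= y] : p.-tuple R -> R).
  have mC : measurable [set x | f x <= y] by exact: measurable_le_fun.
  have := is_cond_prob_indic P mX mC.
  have [N [mN N0 sN]] := fE.
  apply: is_cond_prob_ae_event => //; first exact: measurable_preimageT mC.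
    apply/eqP; rewrite -measure_le0 -N0; apply: le_measure; rewrite ?inE//.
      by apply: measurableD => //; exact: measurable_preimageT mC.
    by move=> w [/= fy nYy]; apply: sN => /= Yf; apply: nYy; rewrite Yf.
  apply/eqP; rewrite -measure_le0 -N0; apply: le_measure; rewrite ?inE//.
    by apply: measurableD => //; exact: measurable_preimageT mC.
  by move=> w [/= Yy nfy]; apply: sN => /= Yf; apply: nfy; rewrite /preimage/= -Yf.
have gE : {ae P, forall w, (g y \o X) w = (\1_[set w | Y w <= y] : Om -> R) w}.
  apply: filterS2 (cond_prob_unique mX (mYy y) (cg y) cf) fE => w /= -> Yf.
  by rewrite !indicE; congr (nat_of_bool _)%:R; apply/idP/idP; rewrite !inE/= Yf.
have [_ /(_ _ s01)[c c01 ->] _] := rep y.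
rewrite (hinge_ae c (mgX y) _ gE); last exact: measurable_indic.
have v01 := Fdist_range Y y; set v := Fdist Y y in v01 *.
have iA : P.-integrable setT (EFin \o (\1_[set w | Y w <= y] : Om -> R)).
  exact: integrable_indic.
(* The event [Y <= y] bounds c s + hinge below by c s + (1 - c) v, a convex combination of [s] and
   [v] because [c] is in [0,1]. *)
have h1 := hinge_ge c (mYy y) iA.
have e1 : \int[P]_(w in [set w | Y w <= y]) (\1_[set w | Y w <= y] : Om -> R) w = v.
  rewrite /Rintegral integral_indic// setIid.
  exact: (congr1 fine (FdistE Y y)).
move: h1; rewrite e1 FdistE /= -/v => h1.
move: c01 v01 => /andP[c0 c1] /andP[v0 v1].
by rewrite ge_min; have [vs|sv] := leP v s; apply/orP; [left|right]; nra.
Qed.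

End extreme_values.

(** * Conditional independence *)

Section joined_vector.
Context (R : realType) (d : measure_display) (Om : measurableType d)
  (P : probability Om R) (Y : {RV P >-> R}) (p q : nat)
  (X : {RV P >-> p.-tuple R}) (Z : {RV P >-> q.-tuple R}).

Let mX : measurable_fun setT X. Proof. exact: measurable_funPT. Qed.
Let mZ : measurable_fun setT Z. Proof. exact: measurable_funPT. Qed.
Let mXZ : measurable_fun setT (join_rv X Z). Proof. exact: measurable_funPT. Qed.
Let mY : measurable_fun setT Y. Proof. exact: measurable_funPT. Qed.
Let mYy y : measurable [set w | Y w <= y]. Proof. exact: measurable_le_fun. Qed.

Definition left_tuple (x : (p + q).-tuple R) : p.-tuple R :=
  [tuple tnth x (lshift q i) | i < p].

Definition right_tuple (x : (p + q).-tuple R) : q.-tuple R :=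
  [tuple tnth x (rshift p i) | i < q].

Lemma left_tuple_join w : left_tuple (join_rv X Z w) = X w.
Proof. by apply: eq_from_tnth => i; rewrite tnth_mktuple tnth_lshift. Qed.

Lemma right_tuple_join w : right_tuple (join_rv X Z w) = Z w.
Proof. by apply: eq_from_tnth => i; rewrite tnth_mktuple tnth_rshift. Qed.

Lemma measurable_left_tuple : measurable_fun setT left_tuple.
Proof.
apply/measurable_fun_tnthP => j; rewrite /comp/=.
apply: (eq_measurable_fun (fun x : (p + q).-tuple R => tnth x (lshift q j))).
  by move=> x _; rewrite tnth_mktuple.
exact: measurable_tnth.
Qed.

Lemma measurable_right_tuple : measurable_fun setT right_tuple.
Proof.
apply/measurable_fun_tnthP => j; rewrite /comp/=.
apply: (eq_measurable_fun (fun x : (p + q).-tuple R => tnth x (rshift p j))).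
  by move=> x _; rewrite tnth_mktuple.
exact: measurable_tnth.
Qed.

Lemma measurable_cat_pair :
  measurable_fun setT (fun x : p.-tuple R * q.-tuple R => [tuple of x.1 ++ x.2]).
Proof.
apply/measurable_fun_tnthP => i; rewrite /comp/=.
case: (split_ordP i) => j ->.
  apply: (eq_measurable_fun (fun x : p.-tuple R * q.-tuple R => tnth x.1 j)).
    by move=> x _; rewrite tnth_lshift.
  exact: (measurableT_comp (measurable_tnth j) measurable_fst).
apply: (eq_measurable_fun (fun x : p.-tuple R * q.-tuple R => tnth x.2 j)).
  by move=> x _; rewrite tnth_rshift.
exact: (measurableT_comp (measurable_tnth j) measurable_snd).
Qed.

Lemma preimage_left_join (D : set (p.-tuple R)) : measurable D ->
  exists2 B', measurable B' & X @^-1` D = join_rv X Z @^-1` B'.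
Proof.
move=> mD; exists (left_tuple @^-1` D).
  exact: measurable_preimageT measurable_left_tuple mD.
by apply/funext => w; rewrite /preimage/mkset left_tuple_join.
Qed.

Lemma preimage_join_prod (D : set (p.-tuple R)) (B : set (q.-tuple R)) :
  measurable D -> measurable B -> exists2 B', measurable B' &
    X @^-1` D `&` Z @^-1` B = join_rv X Z @^-1` B'.
Proof.
move=> mD mB; exists (left_tuple @^-1` D `&` right_tuple @^-1` B).
  by apply: measurableI; [exact: measurable_preimageT measurable_left_tuple mD
    |exact: measurable_preimageT measurable_right_tuple mB].
by apply/funext => w; rewrite /preimage/setI/mkset left_tuple_join right_tuple_join.
Qed.

Section same_prediction.
Context (g : R -> p.-tuple R -> R) (g' : R -> (p + q).-tuple R -> R).
Hypotheses (cg : forall y, is_cond_prob P [set w | Y w <= y] X (g y))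
  (cg' : forall y, is_cond_prob P [set w | Y w <= y] (join_rv X Z) (g' y)).

(** The product of the versions for [Y] and [Z] is shown to be a version for the intersection.
    Pulling out [lB (X)] reduces this to an identity of two weighted laws of [Y], which is checked
    on rays, where [gg'] applies. *)
Lemma same_prediction_cond_independent :
  (forall y, {ae P, forall w, g y (X w) = g' y (join_rv X Z w)}) ->
  cond_independent P Y Z X.
Proof.
move=> gg' A B mA mB.
have mYA : measurable (Y @^-1` A) by exact: measurable_preimageT mA.
have mZB : measurable (Z @^-1` B) by exact: measurable_preimageT mB.
have [kA0 /(cond_prob_clip mX mYA)[kA [ckA kA01]]] := cond_prob_exists X mYA.
have [lB0 /(cond_prob_clip mX mZB)[lB [clB lB01]]] := cond_prob_exists X mZB.
have [mkA ikA _] := ckA; have [mlB ilB _] := clB.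
have kA0' x : 0 <= kA x by have /andP[] := kA01 x.
have lB0' x : 0 <= lB x by have /andP[] := lB01 x.
exists (fun x => lB x * kA x), kA, lB; split => //; last first.
  by apply: aeW => w; rewrite mulrC.
have mYZ : measurable (Y @^-1` A `&` Z @^-1` B) by exact: measurableI.
have mlBX : measurable_fun setT (lB \o X) by exact: measurableT_comp.
have mkAX : measurable_fun setT (kA \o X) by exact: measurableT_comp.
apply/(is_cond_probP P mX mYZ); split.
- exact: measurable_funM.
- apply: (le_integrable measurableT _ _ (integrable_cst_probability P 1 measurableT)).
    by apply/measurable_EFinP; exact: measurable_funM.
  move=> w _; rewrite /= lee_fin normr1 ger0_norm ?mulr_ge0//.
  have /andP[_ k1] := kA01 (X w); have /andP[_ l1] := lB01 (X w).
  by rewrite mulr_ile1.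
move=> D mD; have mXD := measurable_preimageT mX mD.
rewrite (cond_prob_pull_out mX mYA mD ckA kA0' mlB lB01).
pose f1 w := \1_(X @^-1` D) w * lB (X w).
pose f2 : Om -> R := \1_(Z @^-1` B `&` X @^-1` D).
have if1 : P.-integrable setT (EFin \o f1) by exact: integrable_indicM.
have if2 : P.-integrable setT (EFin \o f2).
  by apply: integrable_indic; exact: measurableI.
have f1E C : measurable C ->
    (\int[P]_(w in C) (f1 w)%:E = \int[P]_(w in C `&` X @^-1` D) (lB (X w))%:E)%E.
  move=> mC; rewrite integral_mkcondr; apply: eq_integral => w _.
  by rewrite patchE /f1 indicE; case: ifP => _; rewrite (mul1r, mul0r).
have f2E C : measurable C ->
    (\int[P]_(w in C) (f2 w)%:E = P (C `&` (Z @^-1` B `&` X @^-1` D)))%E.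
  move=> mC; rewrite integral_indic//; first by rewrite setIC.
  exact: measurableI.
have eT : (\int[P]_w (f1 w)%:E = \int[P]_w (f2 w)%:E)%E.
  rewrite f1E// f2E// !setTI; have [_ _ ->//] := (is_cond_probP P mX mZB lB).1 clB.
have ey (y : R) : (\int[P]_(w in [set w | Y w <= y]%R) (f1 w)%:E =
    \int[P]_(w in [set w | Y w <= y]%R) (f2 w)%:E)%E.
  rewrite (f1E _ (mYy y)) (f2E _ (mYy y)).
  have [h [ch h01]] := cond_prob_clip mX (mYy y) (cg y).
  have h0 x : 0 <= h x by have /andP[] := h01 x.
  have [mh _ _] := ch.
  (* The factor is exchanged through [X]: E[lB(X); Y <= y] becomes E[lB(X) h(X)] and then
     E[h(X); Z in B], all on [X] in [D]. There [h (X)] may be replaced by [g' y] of the joined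
     vector. *)
  rewrite -(cond_prob_pull_out mX (mYy y) mD ch h0 mlB lB01).
  under eq_integral do rewrite mulrC.
  rewrite (cond_prob_pull_out mX mZB mD clB lB0' mh h01).
  have [B' mB' eB'] := preimage_join_prod mD mB.
  have [mg' ig' _] := cg' y.
  rewrite [Z @^-1` B `&` _]setIC eB'.
  have [_ _ <-//] := (is_cond_probP P mXZ (mYy y) (g' y)).1 (cg' y).
  apply: ae_eq_integral.
  - exact: measurable_preimageT mB'.
  - by apply: measurable_funTS; apply/measurable_EFinP; exact: measurableT_comp.
  - by apply: measurable_funTS; exact: measurable_int ig'.
  - apply: filterS2 (gg' y) (cond_prob_unique mX (mYy y) (cg y) ch) => w e1 e2 _.
    by rewrite -e1 e2.
have := weighted_law_unique_ray if1 if2 mY mY eT ey mA.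
by rewrite (f1E _ mYA) (f2E _ mYA) => ->; rewrite setIA.
Qed.

(** The clipped version given [X] is shown to be a version given the joined vector. On rectangles,
    pulling out [h (X)] produces the product of conditional probabilities, which conditional
    independence turns into that of the intersection. *)
Lemma cond_independent_same_prediction :
  cond_independent P Y Z X ->
  forall y, {ae P, forall w, g y (X w) = g' y (join_rv X Z w)}.
Proof.
move=> ci y.
have [h [ch h01]] := cond_prob_clip mX (mYy y) (cg y).
have h0 x : 0 <= h x by have /andP[] := h01 x.
have [mh ih _] := ch.
suff cj : is_cond_prob P [set w | Y w <= y] (join_rv X Z) (h \o left_tuple).
  apply: filterS2 (cond_prob_unique mX (mYy y) (cg y) ch)
    (cond_prob_unique mXZ (mYy y) cj (cg' y)) => w e1.
  by rewrite /= left_tuple_join e1.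
have mhl : measurable_fun setT (h \o left_tuple).
  exact: (measurableT_comp mh measurable_left_tuple).
have eh : (h \o left_tuple) \o join_rv X Z = h \o X.
  by apply/funext => w; rewrite /= left_tuple_join.
apply/(is_cond_probP P mXZ (mYy y)); split => //.
  by rewrite eh.
move=> S mS.
pose f2 : Om -> R := \1_[set w | Y w <= y].
have if2 : P.-integrable setT (EFin \o f2) by exact: integrable_indic.
have f2E C : measurable C ->
    (\int[P]_(w in C) (f2 w)%:E = P ([set w | (Y w <= y)%R] `&` C))%E.
  by move=> mC; rewrite integral_indic.
have prodE A B : measurable A -> measurable B ->
  (\int[P]_(w in X @^-1` A `&` Z @^-1` B) (h (X w))%:E =
   \int[P]_(w in X @^-1` A `&` Z @^-1` B) (f2 w)%:E)%E.
  move=> mA mB.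
  have mXA := measurable_preimageT mX mA; have mZB := measurable_preimageT mZ mB.
  rewrite f2E; last exact: measurableI.
  have [g12 [g1 [g2 [c12 c1 c2 e12]]]] := ci _ _ (measurable_itv `]-oo, y]) mB.
  rewrite preimage_Iic in c12 c1.
  have [k [ck k01]] := cond_prob_clip mX mZB c2.
  have k0 x : 0 <= k x by have /andP[] := k01 x.
  have [mk _ _] := ck; have [mg12 ig12 _] := c12.
  rewrite [X @^-1` A `&` _]setIC.
  rewrite -(cond_prob_pull_out mX mZB mA ck k0 mh h01).
  have mYZ : measurable ([set w | Y w <= y] `&` Z @^-1` B) by exact: measurableI.
  rewrite setIA; have [_ _ <-//] := (is_cond_probP P mX mYZ g12).1 c12.
  apply: ae_eq_integral => //.
  - apply: measurable_funTS; apply/measurable_EFinP; apply: measurable_funM => //.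
      exact: (measurableT_comp mh mX).
    exact: (measurableT_comp mk mX).
  - by apply: measurable_funTS; exact: measurable_int ig12.
  - apply: filterS3 e12 (cond_prob_unique mX (mYy y) c1 ch)
      (cond_prob_unique mX mZB c2 ck) => w e1 e2 e3 _.
    by rewrite e1 e2 e3.
(* Events of the joined vector are read as sets of pairs, which rectangles generate. *)
pose C := (fun x : p.-tuple R * q.-tuple R => [tuple of x.1 ++ x.2]) @^-1` S.
have mC : measurable C by exact: measurable_preimageT measurable_cat_pair mS.
have := weighted_law_unique_prod (f1 := h \o X) ih if2 mX mX mZ mZ prodE mC.
rewrite f2E; last exact: (measurable_preimageT mXZ mS).
move=> <-; apply: eq_integral => w _.
by rewrite /= left_tuple_join.
Qed.

End same_prediction.

End joined_vector.

Theorem theorem4p6 (R : realType) (mu : bivector R -> R)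
  (mu_indep : forall W, Rup W -> (mu W = 0 <-> bv_independent W))
  (mu_comon : forall W, Rup W -> (mu W = 1 <-> bv_comonotone W))
  (mu_mono : forall W W', Rup W -> Rup W' ->
     concordance_le W W' -> mu W <= mu W') :
  (forall (d : measure_display) (Om : measurableType d) (P : probability Om R)
          (Y : {RV P >-> R}) (p : nat) (X : {RV P >-> p.-tuple R})
          (d' : measure_display) (Om' : measurableType d')
          (P' : probability Om' R)
          (Y' : {RV P' >-> R}) (p' : nat) (X' : {RV P' >-> p'.-tuple R})
          (r r' : R),
     (0 < p)%N -> (0 < p')%N ->
     continuous (Fdist Y) -> continuous (Fdist Y') ->
     is_Rmu mu Y X r -> is_Rmu mu Y' X' r' ->
     ccx_le Y X Y' X' -> r <= r')
  /\
  (forall (d : measure_display) (Om : measurableType d) (P : probability Om R)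
          (Y : {RV P >-> R}) (p : nat) (X : {RV P >-> p.-tuple R}) (r : R),
     (0 < p)%N -> continuous (Fdist Y) -> is_Rmu mu Y X r -> 0 <= r <= 1)
  /\
  (forall (d : measure_display) (Om : measurableType d) (P : probability Om R)
          (Y : {RV P >-> R}) (p : nat) (X : {RV P >-> p.-tuple R}) (r : R),
     (0 < p)%N -> continuous (Fdist Y) -> is_Rmu mu Y X r ->
     (r = 0 <-> independent P Y X) /\
     (r = 1 <-> exists f : p.-tuple R -> R,
                  measurable_fun setT f /\ {ae P, forall w, Y w = f (X w)}))
  /\
  (forall (d : measure_display) (Om : measurableType d) (P : probability Om R)
          (Y : {RV P >-> R}) (p q : nat)
          (X : {RV P >-> p.-tuple R}) (Z : {RV P >-> q.-tuple R}) (r r' : R),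
     (0 < p)%N -> (0 < q)%N -> continuous (Fdist Y) ->
     is_Rmu mu Y X r -> is_Rmu mu Y (join_rv X Z) r' -> r <= r')
  /\
  (strictly_increasing_on_Rup mu ->
   forall (d : measure_display) (Om : measurableType d) (P : probability Om R)
          (Y : {RV P >-> R}) (p q : nat)
          (X : {RV P >-> p.-tuple R}) (Z : {RV P >-> q.-tuple R}) (r r' : R),
     (0 < p)%N -> (0 < q)%N -> continuous (Fdist Y) ->
     is_Rmu mu Y X r -> is_Rmu mu Y (join_rv X Z) r' ->
     (r = r' <-> cond_independent P Y Z X)).
Proof.
have mX d (Om : measurableType d) (P : probability Om R) p
  (X : {RV P >-> p.-tuple R}) : measurable_fun setT X by exact: measurable_funPT.
have mYy d (Om : measurableType d) (P : probability Om R) (Y : {RV P >-> R}) y :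
    measurable [set w | Y w <= y].
  by apply: measurable_le_fun => //; exact: measurable_funPT.
split; [|split; [|split; [|split]]].
- move=> d Om P Y p X d' Om' P' Y' p' X' r r' _ _ cY cY' Rr Rr' ccx.
  have [W [_ [_ [g [[-> rW] _ _ cg rep]]]]] := is_Rmu_represented cY Rr.
  have [W' [_ [_ [g' [[-> rW'] _ _ cg' rep']]]]] := is_Rmu_represented cY' Rr'.
  apply: mu_mono => //; apply: concordance_leP => // t s t01 s01.
  (* The two conditional events sit at quantiles of the same level [t], where the order compares
     them; continuity gives both the probability [t]. *)
  have eF : Fdist Y (ginv (Fdist Y) t) = Fdist Y' (ginv (Fdist Y') t).
    by rewrite !Fdist_ginv.
  rewrite -(Fdist_ginv cY t01); apply: (joint_le_hinge rep rep' eF) => // c.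
  exact: (ccx_le_hinge c cY cY' ccx t01 (cg _) (cg' _)).
- move=> d Om P Y p X r _ cY Rr.
  have [W [W0 [W1 [g [[-> rW] [rW0 iW0] [rW1 cW1] cg rep]]]]] := is_Rmu_represented cY Rr.
  apply/andP; split.
    (* The independent pair lies below [W] by [joint_ge_product], the comonotone one above it by the
       Frechet-Hoeffding upper bound. *)
    rewrite -[leLHS]((mu_indep _ rW0).2 iW0); apply: mu_mono => //.
    apply: concordance_leP => // t s t01 s01.
    rewrite ((joint_independentP rW0).1 iW0 _ _ t01 s01) -(Fdist_ginv cY t01).
    exact: (joint_ge_product cg rep).
  rewrite -[leRHS]((mu_comon _ rW1).2 cW1); apply: mu_mono => //.
  apply: concordance_leP => // t s t01 s01.
  rewrite ((joint_comonotoneP rW1).1 cW1 _ _ t01 s01) le_min.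
  have [_ j1 j2 _] := joint_range t s rW.
  have ct : clamp01 t = t by rewrite clamp01_id//; case/andP: t01 => *; rewrite !ltW.
  have cs : clamp01 s = s by rewrite clamp01_id//; case/andP: s01 => *; rewrite !ltW.
  by move: j1 j2; rewrite ct cs => -> ->.
- move=> d Om P Y p X r _ cY Rr.
  have [W [_ [_ [g [[-> rW] _ _ cg rep]]]]] := is_Rmu_represented cY Rr.
  split.
    rewrite (mu_indep _ rW) (joint_independentP rW).
    exact: (joint_product_independent cY rW cg rep).
  rewrite (mu_comon _ rW) (joint_comonotoneP rW).
  exact: (joint_min_functional cY rW cg rep).
- move=> d Om P Y p q X Z r r' _ _ cY Rr Rr'.
  have [W [_ [_ [g [[-> rW] _ _ cg rep]]]]] := is_Rmu_represented cY Rr.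
  have [W' [_ [_ [g' [[-> rW'] _ _ cg' rep']]]]] := is_Rmu_represented cY Rr'.
  apply: mu_mono => //; apply: concordance_leP => // t s t01 s01.
  rewrite -(Fdist_ginv cY t01); apply: (joint_le_hinge rep rep') => // c.
  exact: (hinge_refinement (mX _ _ _ _ X) (mX _ _ _ _ (join_rv X Z)) (mYy _ _ _ Y _)
    (@preimage_left_join _ _ _ _ _ _ X Z) (cg _) (cg' _)).
- move=> mu_strict d Om P Y p q X Z r r' _ _ cY Rr Rr'.
  have [W [_ [_ [g [[-> rW] _ _ cg rep]]]]] := is_Rmu_represented cY Rr.
  have [W' [_ [_ [g' [[-> rW'] _ _ cg' rep']]]]] := is_Rmu_represented cY Rr'.
  have hle y c : hinge P (g y \o X) c <= hinge P (g' y \o join_rv X Z) c.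
    exact: (hinge_refinement (mX _ _ _ _ X) (mX _ _ _ _ (join_rv X Z)) (mYy _ _ _ Y _)
      (@preimage_left_join _ _ _ _ _ _ X Z) (cg _) (cg' _)).
  have cWW' : concordance_le W W'.
    apply: concordance_leP => // t s t01 s01.
    by rewrite -(Fdist_ginv cY t01); apply: (joint_le_hinge rep rep').
  split=> [muE|ci].
    have eWW' : bv_eq_law W W'.
      apply: contrapT => nW; have := mu_strict _ _ rW rW' cWW' nW.
      by rewrite muE ltxx.
    apply: (same_prediction_cond_independent cg cg') => y.
    apply: (hinge_refinement_eq (mX _ _ _ _ X) (mX _ _ _ _ (join_rv X Z)) (mYy _ _ _ Y _)
      (@preimage_left_join _ _ _ _ _ _ X Z) (cg _) (cg' _)) => c.
    (* The [s] at which [W'] attains its hinge is inserted into the upper bound for [W]; equality of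
       the joint values leaves the reverse hinge inequality. *)
    have [_ _ /(_ c) [s s01 sE]] := rep' y.
    have [/(_ s c s01) up _ _] := rep y.
    by move: up; rewrite (joint_eq_law eWW') sE lerD2l.
  (* Equal predictions have equal hinges, so [W'] is also below [W], and monotonicity of [mu] in
     both directions gives equality. *)
  apply/eqP; rewrite eq_le mu_mono//=; apply: mu_mono => //.
  apply: concordance_leP => // t s t01 s01.
  rewrite -(Fdist_ginv cY t01); apply: (joint_le_hinge rep' rep) => // c.
  have [mg _ _] := cg (ginv (Fdist Y) t); have [mg' _ _] := cg' (ginv (Fdist Y) t).
  have gg' := cond_independent_same_prediction cg cg' ci (ginv (Fdist Y) t).
  rewrite (hinge_ae c _ _ gg')//.
  - exact: (measurableT_comp mg (mX _ _ _ _ X)).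
  - exact: (measurableT_comp mg' (mX _ _ _ _ (join_rv X Z))).
Qed.
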